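(* The following identities hold: $$\text{(T1)}\quad \sum_{k=0}^\infty\frac{198k^2-227k+47}{\binom{2k}{k}^3}=\frac{3264-4\pi^2}{63},$$ $$\text{(T1}'\text{)}\quad \sum_{k=1}^\infty\frac{4884741k^2-7292783k+2041168}{\binom{2k}{k+1}^3}=\frac{68102148-10093535\pi^2}{126},$$ $$\text{(T2)}\quad \sum_{k=0}^\infty\frac{(54k^2-33k+18)(-8)^k}{\binom{2k}{k}^3}=8+2G,$$ $$\text{(T2}'\text{)}\quad \sum_{k=1}^\infty\frac{(11277k^2-13124k+3212)(-8)^k}{\binom{2k}{k+1}^3}=\frac{38954G-24679}{3},$$ $$\text{(T3)}\quad \sum_{k=0}^\infty\frac{(850k^2-1133k+69)8^k}{\binom{2k}{k}^2\binom{3k}{k}}=\frac{885-12\pi^2}{5},$$ $$\text{(T3}'\text{)}\quad \sum_{k=1}^\infty\frac{(4621650k^2-7550827k+1785654)8^k}{\binom{2k}{k+1}^2\binom{3k}{k+1}}=\frac{6728880-1468127\pi^2}{5},$$ $$\text{(T4)}\quad \sum_{k=0}^\infty\frac{(18k^2-39k-6)16^k}{\binom{2k}{k}^3}=\frac{16-\pi^2}{4},$$ $$\text{(T4}'\text{)}\quad \sum_{k=1}^\infty\frac{(2778k^2-6499k+1679)16^k}{\binom{2k}{k+1}^3}=\frac{89008-20305\pi^2}{12},$$ $$\text{(T5)}\quad \sum_{k=0}^\infty\frac{(315k^2-54k+119)(-27)^k}{\binom{2k}{k}^2\binom{3k}{k}}=\frac{10+216K}{5},$$ $$\text{(T5}'\text{)}\quad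 \sum_{k=1}^\infty\frac{(3391155k^2-3249747k+646792)(-27)^{k-1}}{\binom{2k}{k+1}^2\binom{3k}{k+1}}=\frac{2344210-5115501K}{30},$$ $$\text{(T6)}\quad \sum_{k=0}^\infty\frac{(1298k^2-7807k-3165)64^k}{\binom{2k}{k}^2\binom{3k}{k}}=195-192\pi^2,$$ $$\text{(T6}'\text{)}\quad \sum_{k=1}^\infty\frac{(3470742k^2-20527615k+4631490)64^{k-1}}{\binom{2k}{k+1}^2\binom{3k}{k+1}}=387807-198173\pi^2,$$ $$\text{(T7)}\quad \sum_{k=0}^\infty\frac{(2050k^2-5331k-1357)81^k}{\binom{2k}{k}^2\binom{4k}{2k}}=\frac{8800-2592\pi^2}{35},$$ $$\text{(T7}'\text{)}\quad \sum_{k=1}^\infty\frac{(17439700k^2-47250409k+8929776)81^{k-1}}{\binom{2k}{k+1}^2\binom{4k}{2k+1}}=\frac{143153685-44613764\pi^2}{210},$$ $$\text{(T8)}\quad \sum_{k=0}^\infty\frac{(50k^2+93k+22)(-144)^k}{\binom{2k}{k}^2\binom{4k}{2k}}=\frac{243K-200}{4},$$ $$\text{(T8}'\text{)}\quad \sum_{k=1}^\infty\frac{(53725k^2-27494k+3675)(-144)^{k-1}}{\binom{2k}{k+1}^2\binom{4k}{2k+1}}=\frac{78296-122235K}{128}.$$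
   Context: $G=\sum_{k=0}^\infty\frac{(-1)^k}{(2k+1)^2}$ is the Catalan constant, and $K=\sum_{k=1}^\infty\frac{\left(\frac{k}{3}\right)}{k^2}$, where $\left(\frac{k}{3}\right)$ is the Legendre symbol (equal to $1,-1,0$ according as $k\equiv 1,2,0\pmod 3$). *)

(* Defs.v *)
(* Stdlib reals with Coquelicot. *)
From Stdlib Require Export Reals.
From Stdlib Require Import Arith List Lia.
From Coquelicot Require Export Coquelicot.
Open Scope R_scope.

(* After importing Coquelicot, [C] is the type of complex numbers, so the
   binomial coefficient needs its qualified name. [Binomial.C n k] is
   n! / (k! (n-k)!) with truncated n-k, hence meaningful only for k <= n. *)
Notation binom := Binomial.C.

(* [sum_(k >= m) a k] converges, with sum [l]. *)
Definition is_series_from (m : nat) (a : nat -> R) (l : R) : Prop :=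
  is_series (fun n : nat => a (m + n)%nat) l.

(* The Legendre symbol (a / p), for p an odd prime. *)
Definition legendre (a p : nat) : Z :=
  if (a mod p =? 0)%nat then 0%Z
  else if existsb (fun x : nat => (x * x) mod p =? a mod p)%nat (seq 1 (p - 1))
  then 1%Z else (-1)%Z.

Lemma legendre_3 (k : nat) :
  legendre k 3 = match (k mod 3)%nat with
                 | 0%nat => 0%Z | 1%nat => 1%Z | _ => (-1)%Z
                 end.
Proof.
unfold legendre.
assert (H : (k mod 3 < 3)%nat) by (apply Nat.mod_upper_bound; lia).
destruct (k mod 3)%nat as [|[|[|n]]]; try reflexivity; lia.
Qed.

Definition Catalan_G : R :=
  Series (fun k : nat => (-1) ^ k / (2 * INR k + 1) ^ 2).

(* Sum over k >= 1, reindexed by k = n + 1. *)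
Definition const_K : R :=
  Series (fun n : nat => IZR (legendre (S n) 3) / INR (S n) ^ 2).

(* Main.v *)
(* Each sum is reduced by Gosper summation to one of eight series
   sum_(k >= 1) (alpha k + beta) z^k / (k^3 B_k), where B_k is C(2k,k)^3,
   C(2k,k)^2 C(3k,k) or C(2k,k)^2 C(4k,2k) and z = 1, -8, 16, 8, -27, 64, 81, -144.
   These are evaluated by WZ pairs G(n,k+1) - G(n,k) = U(n+1,k) - U(n,k): when
   sum_n G(n,k) is dominated, sum_n G(n,0) = sum_k U(0,k) + sum_n lim_k G(n,k).
   The boundary sums sum_k U(0,k) are sum_(k odd) 1/k^2, eta(2), K, or
   sum_m z^m / (m^2 C(2m,m)) = 2 arcsin(sqrt z / 2)^2, whose case z = 1 also gives
   zeta(2), again by a WZ pair.  For z = -8 a second WZ pair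
   turns the Catalan series into the same boundary sum.  For z = -144 both the
   boundary sum and the limit contain a constant c (in fact 2 pi) multiplying a
   logarithm of 2 + sqrt 3; a second WZ pair, in the shift of a parameter b = +-1/3,
   expresses the boundary sum through K, and the two logarithmic terms cancel. *)
Require Import Defs.
From Stdlib Require Import Reals.
From Coquelicot Require Import Coquelicot.
From Stdlib Require Import Lra Lia Psatz Arith.
Open Scope R_scope.

(** * Dominated WZ summation *)

(** No two-variable term is written in closed form, which would need Gamma functions. A grid is
    given by its ratios [rho] in [n] and [kappa] in [k], compatible around each unit square, and by
    its values on the two axes. Dividing by the grid turns the WZ equation into an identity of
    rational functions, and domination into a bound of [g (S n) k * rho n k] by [r] times [g n k],
    that is, a polynomial inequality on the nonnegative quadrant. The single value [r = 3 / 4]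
    serves every such transform: the largest limiting ratio along [k = 0] is 64/108. Two WZ steps
    have no geometric decay in the summation index, the one for the Catalan series and the shift of
    [b], and they get their own majorants. The large coefficients of the identities come from the
    reduction step: a quadratic numerator multiplied by [k ^ 3] must agree in all coefficients up to
    degree 5 with an expression in [lam], [s0], [s1], [s2]. These are six homogeneous linear
    equations in seven unknowns, the coefficients of the quadratic included. *)

Lemma is_series_lim (a : nat -> R) (l : R) :
  is_lim_seq (sum_n a) l -> is_series a l.
Proof. intro H; exact H. Qed.

Lemma sum_n_telescope (u : nat -> R) (N : nat) :
  sum_n (fun n => u (S n) - u n) N = u (S N) - u O.
Proof.
induction N as [|N IH]; [now rewrite sum_O|].
rewrite sum_Sn, IH; unfold plus; simpl; ring.
Qed.

Lemma is_series_telescope (u : nat -> R) :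
  is_lim_seq u 0 -> is_series (fun n => u (S n) - u n) (- u O).
Proof.
intro H; apply is_series_lim.
apply is_lim_seq_ext with (fun N => u (S N) - u O).
  now intro N; rewrite sum_n_telescope.
replace (- u O) with (0 - u O) by ring.
apply is_lim_seq_minus'; [now apply -> is_lim_seq_incr_1 in H | apply is_lim_seq_const].
Qed.

Lemma Series_nonneg (a : nat -> R) :
  ex_series a -> (forall n, 0 <= a n) -> 0 <= Series a.
Proof.
intros E H.
assert (E' : ex_series (fun n => Rabs (a n))).
{ apply ex_series_ext with a; [intro n; now rewrite Rabs_pos_eq|exact E]. }
apply Rle_trans with (2 := Req_le _ _ (Series_ext _ _ (fun n => Rabs_pos_eq _ (H n)))).
eapply Rle_trans; [apply Rabs_pos|now apply Series_Rabs].
Qed.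

Lemma Series_tail_lim (M : nat -> R) :
  ex_series M -> is_lim_seq (fun N => Series (fun n => M (S N + n)%nat)) 0.
Proof.
intro HM.
apply is_lim_seq_ext with (fun N => Series M - sum_n M N).
  intro N; rewrite (Series_incr_n M (S N)); [|lia|exact HM].
  rewrite sum_n_Reals; simpl; ring.
replace 0 with (Series M - Series M) by ring.
apply is_lim_seq_minus'; [apply is_lim_seq_const|].
exact (Series_correct M HM).
Qed.

Lemma sum_n_lim0 (D : nat -> nat -> R) (N : nat) :
  (forall n, is_lim_seq (fun k => D k n) 0) ->
  is_lim_seq (fun k => sum_n (D k) N) 0.
Proof.
intro H; induction N as [|N IH].
  apply is_lim_seq_ext with (fun k => D k O); [|apply H].
  now intro k; rewrite sum_O.
apply is_lim_seq_ext with (fun k => sum_n (D k) N + D k (S N)).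
  now intro k; rewrite sum_Sn.
replace 0 with (0 + 0) by ring; now apply is_lim_seq_plus'.
Qed.

(** Dominated convergence for series: cut at an [N] beyond which the tail of [2 * M] is below half
    of epsilon; the finite head of the differences tends to 0 term by term. *)
Lemma tannery (a : nat -> nat -> R) (M L : nat -> R) :
  ex_series M -> (forall n k, Rabs (a k n) <= M n) ->
  (forall n, is_lim_seq (fun k => a k n) (L n)) ->
  ex_series L /\ is_lim_seq (fun k => Series (a k)) (Series L).
Proof.
intros HM Ha HL.
assert (HLM : forall n, Rabs (L n) <= M n).
{ intro n.
  apply (is_lim_seq_le (fun k => Rabs (a k n)) (fun _ => M n) (Rabs (L n)) (M n)).
  - intro k; apply Ha.
  - exact (is_lim_seq_abs _ _ (HL n)).
  - apply is_lim_seq_const. }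
assert (EL : ex_series L) by now apply (ex_series_le L M).
assert (Ea : forall k, ex_series (a k)) by (intro k; now apply (ex_series_le (a k) M)).
split; [exact EL|].
set (D := fun k n => Rabs (a k n - L n)).
assert (HD : forall k n, 0 <= D k n <= 2 * M n).
{ intros k n; split; [apply Rabs_pos|]. unfold D.
  apply Rle_trans with (Rabs (a k n) + Rabs (- L n)); [apply Rabs_triang|].
  rewrite Rabs_Ropp; specialize (Ha n k); specialize (HLM n); lra. }
assert (E2M : ex_series (fun n => 2 * M n)) by now apply (ex_series_scal 2 M).
assert (ED : forall k, ex_series (D k)).
{ intro k; apply (ex_series_le (D k) (fun n => 2 * M n)); [|exact E2M].
  intro n; unfold norm; simpl; unfold abs; simpl.
  rewrite Rabs_pos_eq; apply HD. }
assert (Hdiff : forall k, Rabs (Series (a k) - Series L) <= Series (D k)).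
{ intro k; rewrite <- Series_minus by auto.
  apply Series_Rabs; exact (ED k). }
assert (D0 : is_lim_seq (fun k => Series (D k)) 0).
{ apply is_lim_seq_Reals; intros eps Heps.
  assert (HT := Series_tail_lim (fun n => 2 * M n) E2M).
  apply is_lim_seq_Reals in HT.
  destruct (HT (eps / 2)) as [N HN]; [lra|].
  specialize (HN N (le_n N)).
  assert (HF := sum_n_lim0 D N).
  assert (HF' : is_lim_seq (fun k => sum_n (D k) N) 0).
  { apply HF; intro n; unfold D.
    assert (Hz : is_lim_seq (fun k => a k n - L n) (L n - L n)).
    { apply is_lim_seq_minus'; [apply HL|apply is_lim_seq_const]. }
    replace (L n - L n) with 0 in Hz by ring.
    apply is_lim_seq_abs in Hz; simpl in Hz; now rewrite Rabs_R0 in Hz. }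
  apply is_lim_seq_Reals in HF'.
  destruct (HF' (eps / 2)) as [K HK]; [lra|].
  exists K; intros k Hk; specialize (HK k Hk).
  unfold R_dist in *; rewrite Rminus_0_r in *.
  rewrite (Series_incr_n (D k) (S N)); [|lia|apply ED].
  simpl pred; rewrite <- sum_n_Reals.
  assert (Ht : 0 <= Series (fun n => D k (S N + n)%nat)
             <= Series (fun n => 2 * M (S N + n)%nat)).
  { assert (E' : ex_series (fun n => 2 * M (S N + n)%nat)).
    { now apply (ex_series_incr_n (fun n => 2 * M n)). }
    split.
    - apply Series_nonneg; [now apply (ex_series_incr_n (D k))|intro n; apply HD].
    - apply Series_le; [|exact E']; intro n; apply HD. }
  apply Rabs_def2 in HK; apply Rabs_def2 in HN.
  apply Rabs_def1; [lra|].
  assert (0 <= sum_n (D k) N).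
  { rewrite sum_n_Reals; apply cond_pos_sum; intro n; apply HD. }
  lra. }
apply is_lim_seq_Reals; intros eps Heps.
apply is_lim_seq_Reals in D0; destruct (D0 eps Heps) as [K HK].
exists K; intros k Hk; specialize (HK k Hk); unfold R_dist in *.
rewrite Rminus_0_r in HK.
eapply Rle_lt_trans; [apply Hdiff|].
eapply Rle_lt_trans; [apply Rle_abs|exact HK].
Qed.

(** Summing the WZ equation over [n] telescopes [U], so one step in [k] lowers the sum of [G] by
    [U O k - V k]. Adding these steps leaves the limit of the sums of [G] as [k] grows, which
    [tannery] computes. *)
Lemma wz_sum_lim (G U : nat -> nat -> R) (M L V : nat -> R) :
  (forall n k, G n (S k) - G n k = U (S n) k - U n k) ->
  ex_series M -> (forall n k, Rabs (G n k) <= M n) ->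
  (forall n, is_lim_seq (G n) (L n)) ->
  (forall k, is_lim_seq (fun n => U n k) (V k)) ->
  ex_series L /\ ex_series (fun n => G n O) /\
  is_series (fun k => U O k - V k) (Series (fun n => G n O) - Series L).
Proof.
intros Hwz HM HG HL HU.
destruct (tannery (fun k n => G n k) M L HM HG HL) as [EL HS].
assert (EG : forall k, ex_series (fun n => G n k)).
{ intro k; apply (ex_series_le (fun n => G n k) M); [intro n; apply HG|exact HM]. }
split; [exact EL|split; [apply EG|]].
assert (Hstep : forall k, Series (fun n => G n (S k)) = Series (fun n => G n k) - (U O k - V k)).
{ intro k.
  assert (H1 : is_series (fun n => U (S n) k - V k - (U n k - V k)) (- (U O k - V k))).
  { apply (is_series_telescope (fun n => U n k - V k)).
    replace (Finite 0) with (Finite (V k - V k)) by now rewrite Rminus_diag.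
    apply is_lim_seq_minus'; [apply HU|apply is_lim_seq_const]. }
  apply is_series_unique in H1.
  rewrite <- (Series_ext (fun n => G n (S k) - G n k)) in H1
    by (intro n; rewrite Hwz; ring).
  rewrite Series_minus in H1 by auto. lra. }
apply is_series_lim.
apply is_lim_seq_ext with (fun K => Series (fun n => G n O) - Series (fun n => G n (S K))).
{ intro K; induction K as [|K IH].
  - rewrite sum_O, Hstep; ring.
  - rewrite sum_Sn, <- IH, (Hstep (S K)); unfold plus; simpl; ring. }
apply is_lim_seq_minus'; [apply is_lim_seq_const|].
now apply (is_lim_seq_incr_1 (fun k => Series (fun n => G n k))).
Qed.

(** A bound of [U] by [G], uniform in [n], makes the far boundary vanish, because [G n k] is the
    general term of a convergent series in [n]. *)
Lemma wz_sum (G U : nat -> nat -> R) (M L C : nat -> R) :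
  (forall n k, G n (S k) - G n k = U (S n) k - U n k) ->
  ex_series M -> (forall n k, Rabs (G n k) <= M n) ->
  (forall n, is_lim_seq (G n) (L n)) ->
  (forall n k, Rabs (U n k) <= C k * Rabs (G n k)) ->
  ex_series (fun n => G n O) /\
  is_series (U O) (Series (fun n => G n O) - Series L).
Proof.
intros Hwz HM HG HL HU.
destruct (wz_sum_lim G U M L (fun _ => 0) Hwz HM HG HL) as [_ [EG HS]].
- intro k; apply is_lim_seq_abs_0.
  apply is_lim_seq_le_le with (fun _ => 0) (fun n => C k * Rabs (G n k)).
  + intro n; split; [apply Rabs_pos|apply HU].
  + apply is_lim_seq_const.
  + assert (E : ex_series (fun n => G n k))
      by (apply (ex_series_le (fun n => G n k) M); [intro n; apply HG|exact HM]).
    replace 0 with (C k * Rabs 0) by (rewrite Rabs_R0; ring).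
    apply (is_lim_seq_scal_l _ (C k) (Rabs 0)).
    exact (is_lim_seq_abs _ _ (ex_series_lim_0 _ E)).
- split; [exact EG|].
  apply (is_series_ext (fun k => U O k - 0)); [intro k; apply Rminus_0_r|exact HS].
Qed.

(** * WZ pairs given by their ratios *)

Fixpoint rprod (u : nat -> R) (n : nat) : R :=
  match n with O => 1 | S m => u m * rprod u m end.

(** The hypothesis says that both paths around a unit square give the same product. It suffices to
    go along the axis [k = 0] first and then up the column. *)
Lemma grid_exists (rho kappa : nat -> nat -> R) (h0 : R) :
  (forall n k, rho n (S k) * kappa n k = kappa (S n) k * rho n k) ->
  exists H : nat -> nat -> R,
    H O O = h0 /\ (forall n k, H (S n) k = rho n k * H n k) /\
    (forall n k, H n (S k) = kappa n k * H n k).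
Proof.
intro Hc.
exists (fun n k => h0 * rprod (fun i => rho i O) n * rprod (kappa n) k).
split; [simpl; ring|split].
- intros n k; induction k as [|k IH]; [simpl; ring|].
  simpl rprod at 2. simpl rprod at 4.
  transitivity (kappa (S n) k * (h0 * rprod (fun i => rho i O) (S n) * rprod (kappa (S n)) k)).
    ring.
  rewrite IH.
  transitivity ((kappa (S n) k * rho n k) * (h0 * rprod (fun i => rho i O) n * rprod (kappa n) k)).
    ring.
  rewrite <- Hc; ring.
- intros n k; simpl; ring.
Qed.

Lemma geometric_domination (a : nat -> nat -> R) (r : R) (n k : nat) :
  0 <= r -> (forall n k, Rabs (a (S n) k) <= r * Rabs (a n k)) ->
  Rabs (a n k) <= r ^ n * Rabs (a O k).
Proof.
intros Hr Ha; induction n as [|n IH]; [simpl; lra|].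
eapply Rle_trans; [apply Ha|simpl].
rewrite Rmult_assoc; now apply Rmult_le_compat_l.
Qed.

Lemma is_lim_seq_bounded (u : nat -> R) (l : R) :
  is_lim_seq u l -> exists B, forall n, Rabs (u n) <= B.
Proof.
intro H; assert (E : ex_finite_lim_seq u) by now exists l.
destruct (filterlim_bounded u) as [B HB].
  now exists l.
now exists B.
Qed.

(* [G = g H] and [U = f H], where [H] has the ratios [rho] in [n] and [kappa] in [k],
   and [h0], [hn] are its values on the two axes. *)
Lemma wz_transform (rho kappa f g : nat -> nat -> R) (h0 hn L C : nat -> R)
    (r u l : R) :
  0 <= r < 1 ->
  (forall n k, rho n (S k) * kappa n k = kappa (S n) k * rho n k) ->
  (forall n k, f (S n) k * rho n k - f n k = g n (S k) * kappa n k - g n k) ->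
  (forall n k, Rabs (g (S n) k * rho n k) <= r * Rabs (g n k)) ->
  (forall n k, Rabs (f n k) <= C k * Rabs (g n k)) ->
  (forall k, h0 (S k) = kappa O k * h0 k) ->
  (forall n, hn (S n) = rho n O * hn n) -> h0 O = hn O ->
  is_lim_seq (fun k => g O k * h0 k) (L O) ->
  (forall n, L n = 0 /\ L (S n) = 0 \/
    exists q : R, is_lim_seq (fun k => g (S n) k * rho n k / g n k) q /\
      (forall k, g n k <> 0) /\ L (S n) = q * L n) ->
  is_series (fun k => f O k * h0 k) u -> is_series L l ->
  is_series (fun n => g n O * hn n) (u + l).
Proof.
intros Hr Hc Hwz Hratio Hf H0 Hn H00 HL0 HLn Hu Hl.
destruct (grid_exists rho kappa (h0 O) Hc) as [H [HO [HR HK]]].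
assert (E0 : forall k, H O k = h0 k).
{ intro k; induction k as [|k IH]; [exact HO|now rewrite HK, IH, H0]. }
assert (En : forall n, H n O = hn n).
{ intro n; induction n as [|n IH]; [congruence|now rewrite HR, IH, Hn]. }
set (G := fun n k => g n k * H n k).
set (U := fun n k => f n k * H n k).
assert (HG : forall n k, Rabs (G (S n) k) <= r * Rabs (G n k)).
{ intros n k; unfold G; rewrite HR, <- Rmult_assoc, !Rabs_mult.
  rewrite <- Rmult_assoc; apply Rmult_le_compat_r; [apply Rabs_pos|].
  rewrite <- Rabs_mult; apply Hratio. }
assert (L0' : is_lim_seq (G O) (L O)).
{ apply is_lim_seq_ext with (2 := HL0); intro k; unfold G; now rewrite E0. }
(* Only the limit for [n = 0] is given; the others follow by induction. A zero limit is preserved by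
   the ratio bound alone, a nonzero one needs the limit [q] of the ratio. *)
assert (HGL : forall n, is_lim_seq (G n) (L n)).
{ intro n; induction n as [|n IH]; [exact L0'|].
  destruct (HLn n) as [[Z1 Z2]|[q [Hq [Hg ->]]]].
  - rewrite Z2; rewrite Z1 in IH; apply is_lim_seq_abs_0.
    apply is_lim_seq_le_le with (fun _ => 0) (fun k => r * Rabs (G n k)).
    + intro k; split; [apply Rabs_pos|apply HG].
    + apply is_lim_seq_const.
    + replace 0 with (r * Rabs 0) by (rewrite Rabs_R0; ring).
      apply (is_lim_seq_scal_l _ r (Rabs 0)).
      exact (is_lim_seq_abs _ _ IH).
  - apply is_lim_seq_ext with (fun k => (g (S n) k * rho n k / g n k) * G n k).
    + intro k; unfold G; rewrite HR; field; apply Hg.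
    + exact (is_lim_seq_mult' _ _ q (L n) Hq IH). }
(* Convergence in [k] for [n = 0] gives a bound [B] uniform in [k]; the ratio bound turns it into
   the summable majorant [r ^ n * B]. *)
destruct (is_lim_seq_bounded _ _ L0') as [B HB].
destruct (wz_sum G U (fun n => r ^ n * B) L C) as [EG HS].
- intros n k; unfold G, U; rewrite HR, HK, <- !Rmult_assoc.
  rewrite <- !Rmult_minus_distr_r; now rewrite Hwz.
- apply (ex_series_ext (fun n => B * r ^ n)); [intro n; apply Rmult_comm|].
  apply (ex_series_scal B (fun n => r ^ n)), ex_series_geom.
  rewrite Rabs_pos_eq; lra.
- intros n k; eapply Rle_trans; [apply (geometric_domination G r); [lra|exact HG]|].
  apply Rmult_le_compat_l; [apply pow_le; lra|apply HB].
- exact HGL.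
- intros n k; unfold G, U; rewrite !Rabs_mult, <- Rmult_assoc.
  apply Rmult_le_compat_r; [apply Rabs_pos|apply Hf].
- apply is_series_unique in HS.
  assert (HU : is_series (U O) u).
  { apply is_series_ext with (2 := Hu); intro k; unfold U; now rewrite E0. }
  apply is_series_unique in HU; apply is_series_unique in Hl.
  rewrite HU, Hl in HS.
  apply is_series_ext with (fun n => G n O); [intro n; unfold G; now rewrite En|].
  replace (u + l) with (Series (fun n => G n O)) by lra.
  now apply Series_correct.
Qed.

Lemma wz_transform0 (rho kappa f g : nat -> nat -> R) (h0 hn C : nat -> R) (r u : R) :
  0 <= r < 1 ->
  (forall n k, rho n (S k) * kappa n k = kappa (S n) k * rho n k) ->
  (forall n k, f (S n) k * rho n k - f n k = g n (S k) * kappa n k - g n k) ->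
  (forall n k, Rabs (g (S n) k * rho n k) <= r * Rabs (g n k)) ->
  (forall n k, Rabs (f n k) <= C k * Rabs (g n k)) ->
  (forall k, h0 (S k) = kappa O k * h0 k) ->
  (forall n, hn (S n) = rho n O * hn n) -> h0 O = hn O ->
  is_lim_seq (fun k => g O k * h0 k) 0 ->
  is_series (fun k => f O k * h0 k) u ->
  is_series (fun n => g n O * hn n) u.
Proof.
intros Hr Hc Hwz Hratio Hf H0 Hn H00 HL0 Hu.
rewrite <- (Rplus_0_r u).
apply (wz_transform rho kappa f g h0 hn (fun _ => 0) C r u 0); auto.
apply is_series_lim; apply is_lim_seq_ext with (fun _ => 0).
  intro n; rewrite sum_n_const; ring.
apply is_lim_seq_const.
Qed.

(** * Binomial summands and Gosper reduction *)

Lemma binom_pos (n i : nat) : 0 < binom n i.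
Proof.
unfold binom; apply Rdiv_lt_0_compat; [apply INR_fact_lt_0|].
apply Rmult_lt_0_compat; apply INR_fact_lt_0.
Qed.

Lemma INR_S_gt0 (n : nat) : 0 < INR (S n).
Proof. apply lt_0_INR; lia. Qed.

Lemma binom_succ_top (n i : nat) : (i <= n)%nat ->
  binom (S n) i * (INR (S n) - INR i) = INR (S n) * binom n i.
Proof.
intro H; rewrite pascal_step2 by exact H.
rewrite minus_INR by lia. field.
assert (INR i < INR (S n)) by (apply lt_INR; lia); lra.
Qed.

Lemma binom_succ_bottom (n i : nat) : (i < n)%nat ->
  binom n (S i) * INR (S i) = (INR n - INR i) * binom n i.
Proof.
intro H; rewrite pascal_step3 by exact H.
rewrite minus_INR by lia; field.
assert (0 < INR (S i)) by apply INR_S_gt0; lra.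
Qed.

Lemma INR_3 : INR 3 = 3. Proof. simpl; ring. Qed.
Lemma INR_4 : INR 4 = 4. Proof. simpl; ring. Qed.

Lemma binom_2 (k : nat) :
  binom (2 * S k) (S k) * (INR k + 1) = 2 * (2 * INR k + 1) * binom (2 * k) k.
Proof.
assert (P := pos_INR k).
replace (2 * S k)%nat with (S (S (2 * k))) by lia.
assert (A := binom_succ_top (2 * k) k ltac:(lia)).
assert (B := binom_succ_top (S (2 * k)) k ltac:(lia)).
assert (D := binom_succ_bottom (S (S (2 * k))) k ltac:(lia)).
rewrite !S_INR, !mult_INR in *; change (INR 2) with 2 in *.
set (b0 := binom (2 * k) k) in *; set (b1 := binom (S (2 * k)) k) in *.
set (b2 := binom (S (S (2 * k))) k) in *; set (x := INR k) in *.
rewrite D.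
replace b2 with (2 * (x + 1) * b1 / (x + 2)) by (field_simplify_eq; lra).
replace b1 with ((2 * x + 1) * b0 / (x + 1)) by (field_simplify_eq; lra).
field; lra.
Qed.

Lemma binom_3 (k : nat) :
  binom (3 * S k) (S k) * (2 * (INR k + 1) * (2 * INR k + 1))
  = 3 * (3 * INR k + 1) * (3 * INR k + 2) * binom (3 * k) k.
Proof.
assert (P := pos_INR k).
replace (3 * S k)%nat with (S (S (S (3 * k)))) by lia.
assert (A := binom_succ_top (3 * k) k ltac:(lia)).
assert (B := binom_succ_top (S (3 * k)) k ltac:(lia)).
assert (E := binom_succ_top (S (S (3 * k))) k ltac:(lia)).
assert (D := binom_succ_bottom (S (S (S (3 * k)))) k ltac:(lia)).
rewrite !S_INR, !mult_INR, ?INR_3 in *; change (INR 2) with 2 in *.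
set (b0 := binom (3 * k) k) in *; set (b1 := binom (S (3 * k)) k) in *.
set (b2 := binom (S (S (3 * k))) k) in *.
set (b3 := binom (S (S (S (3 * k)))) k) in *.
set (x := INR k) in *.
replace (binom (S (S (S (3 * k)))) (S k)) with ((2 * x + 3) * b3 / (x + 1))
  by (field_simplify_eq; lra).
replace b3 with (3 * (x + 1) * b2 / (2 * x + 3)) by (field_simplify_eq; lra).
replace b2 with ((3 * x + 2) * b1 / (2 * x + 2)) by (field_simplify_eq; lra).
replace b1 with ((3 * x + 1) * b0 / (2 * x + 1)) by (field_simplify_eq; lra).
field; lra.
Qed.

Lemma binom_4 (k : nat) :
  binom (4 * S k) (2 * S k) * ((INR k + 1) * (2 * INR k + 1))
  = 2 * (4 * INR k + 1) * (4 * INR k + 3) * binom (4 * k) (2 * k).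
Proof.
assert (P := pos_INR k).
assert (A := binom_2 (2 * k)). assert (B := binom_2 (S (2 * k))).
replace (2 * S (2 * k))%nat with (2 * (S (2 * k)))%nat in * by lia.
replace (2 * S (S (2 * k)))%nat with (4 * S k)%nat in B by lia.
replace (S (S (2 * k))) with (2 * S k)%nat in B by lia.
replace (2 * (2 * k))%nat with (4 * k)%nat in A by lia.
rewrite !S_INR, !mult_INR in *; change (INR 2) with 2 in *.
set (b1 := binom (2 * S (2 * k)) (S (2 * k))) in *.
replace b1 with (2 * (2 * (2 * INR k) + 1) * binom (4 * k) (2 * k) / (2 * INR k + 1)) in B
  by (rewrite <- A; field; lra).
set (c1 := binom (4 * S k) (2 * S k)) in *. set (c0 := binom (4 * k) (2 * k)) in *.
apply Rmult_eq_reg_l with 2; [|lra].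
transitivity ((2 * INR k + 1) * (c1 * (2 * INR k + 1 + 1))); [ring|].
rewrite B; field; lra.
Qed.

(* The summands are indexed by [n], standing for [k = n + 1]. *)
Definition term2 (z : R) (n : nat) : R :=
  z ^ S n / (INR (S n) ^ 3 * binom (2 * S n) (S n) ^ 3).
Definition term3 (z : R) (n : nat) : R :=
  z ^ S n / (INR (S n) ^ 3 * (binom (2 * S n) (S n) ^ 2 * binom (3 * S n) (S n))).
Definition term4 (z : R) (n : nat) : R :=
  z ^ S n / (INR (S n) ^ 3 * (binom (2 * S n) (S n) ^ 2 * binom (4 * S n) (2 * S n))).

Lemma term2_succ (z : R) (n : nat) :
  term2 z (S n) = z * INR (S n) ^ 3 / (8 * (2 * INR (S n) + 1) ^ 3) * term2 z n.
Proof.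
unfold term2. assert (H := binom_2 (S n)). assert (P := INR_S_gt0 n).
set (c := binom (2 * S (S n)) (S (S n))) in *.
set (d := binom (2 * S n) (S n)) in *.
assert (Hd : 0 < d) by apply binom_pos.
replace c with (2 * (2 * INR (S n) + 1) * d / (INR (S n) + 1)) by (rewrite <- H; field; lra).
rewrite (S_INR (S n)).
replace (z ^ S (S n)) with (z * z ^ S n) by reflexivity.
field; repeat split; lra.
Qed.

Lemma term3_succ (z : R) (n : nat) :
  term3 z (S n) = z * INR (S n) ^ 3 /
    (6 * (2 * INR (S n) + 1) * (3 * INR (S n) + 1) * (3 * INR (S n) + 2)) * term3 z n.
Proof.
unfold term3. assert (H := binom_2 (S n)). assert (H3 := binom_3 (S n)).
assert (P := INR_S_gt0 n).
set (c := binom (2 * S (S n)) (S (S n))) in *.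
set (d := binom (2 * S n) (S n)) in *.
set (c3 := binom (3 * S (S n)) (S (S n))) in *.
set (d3 := binom (3 * S n) (S n)) in *.
assert (Hd : 0 < d) by apply binom_pos.
assert (Hd3 : 0 < d3) by apply binom_pos.
replace c with (2 * (2 * INR (S n) + 1) * d / (INR (S n) + 1)) by (rewrite <- H; field; lra).
replace c3 with (3 * (3 * INR (S n) + 1) * (3 * INR (S n) + 2) * d3 /
  (2 * (INR (S n) + 1) * (2 * INR (S n) + 1))) by (rewrite <- H3; field; lra).
rewrite (S_INR (S n)).
replace (z ^ S (S n)) with (z * z ^ S n) by reflexivity.
field; repeat split; lra.
Qed.

Lemma term4_succ (z : R) (n : nat) :
  term4 z (S n) = z * INR (S n) ^ 3 /
    (8 * (2 * INR (S n) + 1) * (4 * INR (S n) + 1) * (4 * INR (S n) + 3)) * term4 z n.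
Proof.
unfold term4. assert (H := binom_2 (S n)). assert (H3 := binom_4 (S n)).
assert (P := INR_S_gt0 n).
set (c := binom (2 * S (S n)) (S (S n))) in *.
set (d := binom (2 * S n) (S n)) in *.
set (c3 := binom (4 * S (S n)) (2 * S (S n))) in *.
set (d3 := binom (4 * S n) (2 * S n)) in *.
assert (Hd : 0 < d) by apply binom_pos.
assert (Hd3 : 0 < d3) by apply binom_pos.
replace c with (2 * (2 * INR (S n) + 1) * d / (INR (S n) + 1)) by (rewrite <- H; field; lra).
replace c3 with (2 * (4 * INR (S n) + 1) * (4 * INR (S n) + 3) * d3 /
  ((INR (S n) + 1) * (2 * INR (S n) + 1))) by (rewrite <- H3; field; lra).
rewrite (S_INR (S n)).
replace (z ^ S (S n)) with (z * z ^ S n) by reflexivity.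
field; repeat split; lra.
Qed.

Lemma term2_0 (z : R) : term2 z 0 = z / 8.
Proof. unfold term2, binom; simpl; field. Qed.
Lemma term3_0 (z : R) : term3 z 0 = z / 12.
Proof. unfold term3, binom; simpl; field. Qed.
Lemma term4_0 (z : R) : term4 z 0 = z / 24.
Proof. unfold term4, binom; simpl; field. Qed.

(** These are the terms of a series that converges by the ratio test. *)
Lemma INR_mult_geom_lim (p : nat) (q : R) : 0 <= q < 1 ->
  is_lim_seq (fun n => INR (S n) ^ p * q ^ n) 0.
Proof.
intros [[Hq|<-] Hq1].
(* For [q = 0] the term at [n = 0] contains [0 ^ 0 = 1]; the shift discards it. *)
2:{ apply is_lim_seq_incr_1; apply is_lim_seq_ext with (fun _ => 0).
    intro n; simpl; ring. apply is_lim_seq_const. }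
apply ex_series_lim_0.
apply ex_series_Rabs, ex_series_DAlembert with q; [exact Hq1| |].
- intro n; apply Rgt_not_eq, Rmult_lt_0_compat; apply pow_lt; [apply INR_S_gt0|exact Hq].
- apply is_lim_seq_ext with (fun n => (1 + / INR (S n)) ^ p * q).
  + intro n. assert (P := INR_S_gt0 n).
    rewrite Rabs_pos_eq.
    * replace (1 + / INR (S n)) with (INR (S (S n)) / INR (S n)) by (rewrite (S_INR (S n)); field; lra).
      unfold Rdiv at 1; rewrite Rpow_mult_distr, pow_inv; simpl pow; field.
      repeat split; apply Rgt_not_eq;
        first [apply pow_lt; exact P | apply pow_lt; exact Hq | exact P | exact Hq].
    * apply Rlt_le, Rdiv_lt_0_compat; apply Rmult_lt_0_compat; apply pow_lt;
        first [apply INR_S_gt0|exact Hq].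
  + assert (Hl : is_lim_seq (fun n => (1 + / INR (S n)) ^ p) 1).
    { replace (Finite 1) with (Finite ((1 + 0) ^ p)) by now rewrite Rplus_0_r, pow1.
      apply (is_lim_seq_continuous (fun x => x ^ p)).
      - apply derivable_continuous_pt, derivable_pt_pow.
      - apply is_lim_seq_plus'; [apply is_lim_seq_const|].
        apply (is_lim_seq_incr_1 (fun n => / INR n)).
        replace (Finite 0) with (Rbar_inv p_infty) by reflexivity.
        apply is_lim_seq_inv; [apply is_lim_seq_INR|discriminate]. }
    replace (Finite q) with (Finite (1 * q)) by now rewrite Rmult_1_l.
    apply is_lim_seq_mult'; [exact Hl|apply is_lim_seq_const].
Qed.

(** Degree 5 is that of the Gosper certificates below, a quadratic times a cubic. *)
Lemma poly5_geom_lim (b : nat -> R) (r c0 c1 c2 c3 c4 c5 : R) :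
  0 <= r < 1 -> (forall n, Rabs (b (S n)) <= r * Rabs (b n)) ->
  is_lim_seq (fun n => let k := INR (S n) in
    (c0 + c1 * k + c2 * k ^ 2 + c3 * k ^ 3 + c4 * k ^ 4 + c5 * k ^ 5) * b n) 0.
Proof.
intros Hr Hb.
assert (H : forall c p, is_lim_seq (fun n => c * INR (S n) ^ p * b n) 0).
{ intros c p; apply is_lim_seq_abs_0.
  apply is_lim_seq_le_le with (fun _ => 0)
    (fun n => Rabs c * Rabs (b O) * (INR (S n) ^ p * r ^ n)).
  - intro n; split; [apply Rabs_pos|].
    rewrite !Rabs_mult, (Rabs_pos_eq (INR (S n) ^ p)) by (apply pow_le, pos_INR).
    assert (Hg := geometric_domination (fun n _ => b n) r n O (proj1 Hr) (fun n _ => Hb n)).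
    simpl in Hg.
    transitivity (Rabs c * INR (S n) ^ p * (r ^ n * Rabs (b O))); [|right; ring].
    apply Rmult_le_compat_l; [|exact Hg].
    apply Rmult_le_pos; [apply Rabs_pos|apply pow_le, pos_INR].
  - apply is_lim_seq_const.
  - replace 0 with (Rabs c * Rabs (b O) * 0) by ring.
    apply (is_lim_seq_scal_l _ (Rabs c * Rabs (b O)) 0), INR_mult_geom_lim, Hr. }
apply is_lim_seq_ext with (fun n => c0 * INR (S n) ^ 0 * b n + c1 * INR (S n) ^ 1 * b n
  + c2 * INR (S n) ^ 2 * b n + c3 * INR (S n) ^ 3 * b n + c4 * INR (S n) ^ 4 * b n
  + c5 * INR (S n) ^ 5 * b n).
  intro n; simpl; ring.
replace 0 with (0 + 0 + 0 + 0 + 0 + 0) by ring.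
repeat apply is_lim_seq_plus'; apply H.
Qed.

Lemma is_series_mod_telescope (a t u : nat -> R) (lam s : R) :
  is_series a s -> is_lim_seq u 0 ->
  (forall n, t n = lam * a n + (u (S n) - u n)) ->
  is_series t (lam * s - u O).
Proof.
intros Ha Hu Ht.
apply is_series_ext with (fun n => plus (scal lam (a n)) (u (S n) - u n)).
  intro n; now rewrite Ht.
apply (is_series_plus (fun n => scal lam (a n)) (fun n => u (S n) - u n) (lam * s) (- u O)).
- now apply (is_series_scal lam a).
- now apply is_series_telescope.
Qed.

Lemma Rabs_ratio_le (c r x y : R) : Rabs c <= r -> y = c * x -> Rabs y <= r * Rabs x.
Proof.
intros H ->; rewrite Rabs_mult; apply Rmult_le_compat_r; [apply Rabs_pos|exact H].
Qed.

Lemma Rabs_scaled_fraction (z p q r : R) :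
  0 <= p -> 0 < q -> Rabs z * p <= r * q -> Rabs (z * p / q) <= r.
Proof.
intros Hp Hq H.
unfold Rdiv; rewrite !Rabs_mult, Rabs_inv, (Rabs_pos_eq p), (Rabs_pos_eq q) by lra.
apply Rmult_le_reg_r with q; [exact Hq|].
rewrite Rmult_assoc, Rinv_l by lra; lra.
Qed.

(** 64, and likewise 108 and 256 for the other two families, is the growth rate of the product of
    binomials, hence the radius of convergence. The ratio of consecutive terms stays below its limit
    in absolute value. *)
Lemma term2_geom (z : R) (n : nat) :
  Rabs (term2 z (S n)) <= Rabs z / 64 * Rabs (term2 z n).
Proof.
eapply Rabs_ratio_le; [|apply term2_succ].
assert (P := INR_S_gt0 n); set (k := INR (S n)) in *.
assert (Hz := Rabs_pos z).
assert (0 < k ^ 2) by (apply pow_lt; lra).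
assert (0 < k ^ 3) by (apply pow_lt; lra).
apply Rabs_scaled_fraction; [lra| |].
  apply Rmult_lt_0_compat; [lra|apply pow_lt; lra].
replace (Rabs z / 64 * (8 * (2 * k + 1) ^ 3))
  with (Rabs z * (k ^ 3 + (12 * k ^ 2 + 6 * k + 1) / 8)) by field.
apply Rmult_le_compat_l; lra.
Qed.

Lemma term3_geom (z : R) (n : nat) :
  Rabs (term3 z (S n)) <= Rabs z / 108 * Rabs (term3 z n).
Proof.
eapply Rabs_ratio_le; [|apply term3_succ].
assert (P := INR_S_gt0 n); set (k := INR (S n)) in *.
assert (Hz := Rabs_pos z).
assert (0 < k ^ 2) by (apply pow_lt; lra).
assert (0 < k ^ 3) by (apply pow_lt; lra).
apply Rabs_scaled_fraction; [lra| |].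
  repeat apply Rmult_lt_0_compat; lra.
replace (Rabs z / 108 * (6 * (2 * k + 1) * (3 * k + 1) * (3 * k + 2)))
  with (Rabs z * (k ^ 3 + (27 * k ^ 2 + 13 * k + 2) / 18)) by field.
apply Rmult_le_compat_l; lra.
Qed.

Lemma term4_geom (z : R) (n : nat) :
  Rabs (term4 z (S n)) <= Rabs z / 256 * Rabs (term4 z n).
Proof.
eapply Rabs_ratio_le; [|apply term4_succ].
assert (P := INR_S_gt0 n); set (k := INR (S n)) in *.
assert (Hz := Rabs_pos z).
assert (0 < k ^ 2) by (apply pow_lt; lra).
assert (0 < k ^ 3) by (apply pow_lt; lra).
apply Rabs_scaled_fraction; [lra| |].
  repeat apply Rmult_lt_0_compat; lra.
replace (Rabs z / 256 * (8 * (2 * k + 1) * (4 * k + 1) * (4 * k + 3)))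
  with (Rabs z * (k ^ 3 + (48 * k ^ 2 + 22 * k + 3) / 32)) by field.
apply Rmult_le_compat_l; lra.
Qed.

(* In the applications [lam] and [s0], [s1], [s2] solve the linear system that equates
   the coefficients of the two sides (Gosper's algorithm). *)
Lemma term2_reduction (z alpha beta lam s0 s1 s2 s : R) (P : R -> R) :
  Rabs z < 64 ->
  is_series (fun n => (alpha * INR (S n) + beta) * term2 z n) s ->
  (forall k, P k = lam * (alpha * k + beta)
     + z / 8 * k ^ 3 * (s0 + s1 * (k + 1) + s2 * (k + 1) ^ 2)
     - (2 * k - 1) ^ 3 * (s0 + s1 * k + s2 * k ^ 2)) ->
  is_series (fun n => P (INR (S n)) * term2 z n) (lam * s - (s0 + s1 + s2) * z / 8).
Proof.
intros Hz Hs HP.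
assert (Hz0 := Rabs_pos z).
(* Shifted by one, the factor [(2 * k - 1) ^ 3] becomes the denominator [(2 * k + 1) ^ 3] of the
   term ratio, so the shifted certificate is a polynomial times [term2 z n]. The cubic factors in
   the next two reductions are chosen in the same way. *)
set (u := fun n => let k := INR (S n) in
  (s0 + s1 * k + s2 * k ^ 2) * (2 * k - 1) ^ 3 * term2 z n).
replace ((s0 + s1 + s2) * z / 8) with (u O)
  by (unfold u; rewrite term2_0; simpl; field).
apply is_series_mod_telescope with (1 := Hs).
- assert (H := poly5_geom_lim (term2 z) (Rabs z / 64) (- s0) (6 * s0 - s1)
    (6 * s1 - 12 * s0 - s2) (8 * s0 - 12 * s1 + 6 * s2) (8 * s1 - 12 * s2) (8 * s2)
    ltac:(lra) (term2_geom z)).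
  apply is_lim_seq_ext with (2 := H); intro n; unfold u; simpl; ring.
- intro n; unfold u; cbv zeta; rewrite HP, term2_succ, (S_INR (S n)).
  assert (Q := INR_S_gt0 n); field; lra.
Qed.

Lemma term3_reduction (z alpha beta lam s0 s1 s2 s : R) (P : R -> R) :
  Rabs z < 108 ->
  is_series (fun n => (alpha * INR (S n) + beta) * term3 z n) s ->
  (forall k, P k = lam * (alpha * k + beta)
     + z / 6 * k ^ 3 * (s0 + s1 * (k + 1) + s2 * (k + 1) ^ 2)
     - (2 * k - 1) * (3 * k - 2) * (3 * k - 1) * (s0 + s1 * k + s2 * k ^ 2)) ->
  is_series (fun n => P (INR (S n)) * term3 z n) (lam * s - (s0 + s1 + s2) * z / 6).
Proof.
intros Hz Hs HP.
assert (Hz0 := Rabs_pos z).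
set (u := fun n => let k := INR (S n) in
  (s0 + s1 * k + s2 * k ^ 2) * ((2 * k - 1) * (3 * k - 2) * (3 * k - 1)) * term3 z n).
replace ((s0 + s1 + s2) * z / 6) with (u O)
  by (unfold u; rewrite term3_0; simpl; field).
apply is_series_mod_telescope with (1 := Hs).
- assert (H := poly5_geom_lim (term3 z) (Rabs z / 108) (- 2 * s0) (13 * s0 - 2 * s1)
    (13 * s1 - 27 * s0 - 2 * s2) (18 * s0 - 27 * s1 + 13 * s2) (18 * s1 - 27 * s2) (18 * s2)
    ltac:(lra) (term3_geom z)).
  apply is_lim_seq_ext with (2 := H); intro n; unfold u; simpl; ring.
- intro n; unfold u; cbv zeta; rewrite HP, term3_succ, (S_INR (S n)).
  assert (Q := INR_S_gt0 n); field; lra.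
Qed.

Lemma term4_reduction (z alpha beta lam s0 s1 s2 s : R) (P : R -> R) :
  Rabs z < 256 ->
  is_series (fun n => (alpha * INR (S n) + beta) * term4 z n) s ->
  (forall k, P k = lam * (alpha * k + beta)
     + z / 8 * k ^ 3 * (s0 + s1 * (k + 1) + s2 * (k + 1) ^ 2)
     - (2 * k - 1) * (4 * k - 3) * (4 * k - 1) * (s0 + s1 * k + s2 * k ^ 2)) ->
  is_series (fun n => P (INR (S n)) * term4 z n) (lam * s - (s0 + s1 + s2) * z / 8).
Proof.
intros Hz Hs HP.
assert (Hz0 := Rabs_pos z).
set (u := fun n => let k := INR (S n) in
  (s0 + s1 * k + s2 * k ^ 2) * ((2 * k - 1) * (4 * k - 3) * (4 * k - 1)) * term4 z n).
replace ((s0 + s1 + s2) * z / 8) with (u O)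
  by (unfold u; rewrite term4_0; simpl; field).
apply is_series_mod_telescope with (1 := Hs).
- assert (H := poly5_geom_lim (term4 z) (Rabs z / 256) (- 3 * s0) (22 * s0 - 3 * s1)
    (22 * s1 - 48 * s0 - 3 * s2) (32 * s0 - 48 * s1 + 22 * s2) (32 * s1 - 48 * s2) (32 * s2)
    ltac:(lra) (term4_geom z)).
  apply is_lim_seq_ext with (2 := H); intro n; unfold u; simpl; ring.
- intro n; unfold u; cbv zeta; rewrite HP, term4_succ, (S_INR (S n)).
  assert (Q := INR_S_gt0 n); field; lra.
Qed.

(** * Estimates and limits of rational functions *)

(** Clears all denominators in the ratio condition of [wz_transform]; the polynomial inequality that
    remains is settled by looking at coefficients. *)
Lemma Rabs_ratio_bound (a b g' g p q : R) :
  0 < b -> 0 <= g' -> 0 <= g -> 0 <= p -> 0 < q ->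
  b * (g' * p) <= a * (g * q) ->
  Rabs (g' * (p / q)) <= a / b * Rabs g.
Proof.
intros Hb Hg' Hg Hp Hq H.
assert (0 <= p / q) by (apply Rdiv_le_0_compat; lra).
rewrite (Rabs_pos_eq g Hg), Rabs_pos_eq by now apply Rmult_le_pos.
apply Rmult_le_reg_l with (b * q); [nra|].
replace (b * q * (g' * (p / q))) with (b * (g' * p)) by (field; lra).
replace (b * q * (a / b * g)) with (a * (g * q)) by (field; lra).
exact H.
Qed.

Lemma Rabs_ratio_bound_neg (a b g' g p q : R) :
  0 < b -> 0 <= g' -> 0 <= g -> 0 <= p -> 0 < q ->
  b * (g' * p) <= a * (g * q) ->
  Rabs (g' * - (p / q)) <= a / b * Rabs g.
Proof.
rewrite Ropp_mult_distr_r_reverse, Rabs_Ropp; apply Rabs_ratio_bound.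
Qed.

Lemma Rabs_le_scaled (c f g : R) : 0 <= f -> 0 <= g -> f <= c * g -> Rabs f <= c * Rabs g.
Proof. intros; rewrite !Rabs_pos_eq; assumption. Qed.

Ltac pos := first [ assumption | lra | apply Rmult_lt_0_compat; pos | apply pow_lt; pos
  | apply Rinv_0_lt_compat; pos | apply Rdiv_lt_0_compat; pos ].
Ltac nonneg := first
  [ assumption | lra | apply Rplus_le_le_0_compat; nonneg | apply Rmult_le_pos; nonneg
  | apply pow_le; nonneg | apply Rdiv_le_0_compat; [nonneg|pos]
  | apply Rlt_le, Rinv_0_lt_compat; pos ].
(* Expands [b - a] in variables that are nonnegative; all coefficients are then nonnegative. *)
Ltac poly_le := apply Rminus_le_0; ring_simplify; nonneg.
Ltac vars n k := rewrite ?S_INR; change (INR 0) with 0;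
  assert (Hx := pos_INR n); assert (Hy := pos_INR k);
  set (x := INR n) in *; set (y := INR k) in *; clearbody x y.
(** Equalities produced by [sum_n_ext] live in the carrier of an algebraic structure; retyped over
    [R] they are accessible to [ring] and [field]. *)
Ltac eqR := match goal with |- ?a = ?b => change (@eq R a b) end.
Ltac wz_field := let n := fresh "n" in let k := fresh "k" in
  intros n k; cbv beta; vars n k; field; repeat split; lra.

Lemma series_ext (a b : nat -> R) (l : R) :
  is_series a l -> (forall n, a n = b n) -> is_series b l.
Proof. intros H E; exact (is_series_ext _ _ _ E H). Qed.

Lemma series_scal (a b : nat -> R) (c l l' : R) :
  is_series a l -> (forall n, c * a n = b n) -> c * l = l' -> is_series b l'.
Proof. intros H E <-; apply series_ext with (2 := E), (is_series_scal c a l H). Qed.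

Lemma is_lim_seq_inv_succ : is_lim_seq (fun n => / (INR n + 1)) 0.
Proof.
apply is_lim_seq_ext with (fun n => / INR (S n)).
  intro n; now rewrite S_INR.
apply (is_lim_seq_incr_1 (fun n => / INR n)).
replace (Finite 0) with (Rbar_inv p_infty) by reflexivity.
apply is_lim_seq_inv; [apply is_lim_seq_INR|discriminate].
Qed.

Lemma lim0_of_bound (C : R) (u : nat -> R) :
  (forall k, Rabs (u k) <= C / (INR k + 1)) -> is_lim_seq u 0.
Proof.
intro H; apply is_lim_seq_abs_0.
apply is_lim_seq_le_le with (fun _ => 0) (fun k => C * / (INR k + 1)).
- intro k; split; [apply Rabs_pos|apply H].
- apply is_lim_seq_const.
- replace 0 with (C * 0) by ring; apply (is_lim_seq_scal_l _ C 0), is_lim_seq_inv_succ.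
Qed.

Lemma frac_lim0 (C : R) (u : nat -> R) (p q : R -> R) :
  (forall k, Rabs (u k) = p (INR k) / q (INR k)) ->
  (forall y, 0 <= y -> 0 < q y /\ p y * (y + 1) <= C * q y) ->
  is_lim_seq u 0.
Proof.
intros E H; apply lim0_of_bound with C; intro k; rewrite E.
assert (Hy := pos_INR k); destruct (H _ Hy) as [Hq Hpq].
apply Rmult_le_reg_l with (q (INR k) * (INR k + 1)); [nra|].
field_simplify; lra.
Qed.

(** * Terms of the arcsine series, and elementary limits *)

Lemma central_succ (n : nat) :
  binom (2 * S (S n)) (S (S n)) = 2 * (2 * INR n + 3) / (INR n + 2) * binom (2 * S n) (S n).
Proof.
assert (H := binom_2 (S n)); assert (P := pos_INR n); rewrite S_INR in H.
apply Rmult_eq_reg_r with (INR n + 1 + 1); [rewrite H; field|]; lra.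
Qed.

Definition arcsin_term (z : R) (n : nat) : R :=
  z ^ S n / (INR (S n) ^ 2 * binom (2 * S n) (S n)).

Lemma arcsin_term_succ (z : R) (n : nat) :
  arcsin_term z (S n) = z * (INR n + 1) ^ 2 / (2 * (INR n + 2) * (2 * INR n + 3)) * arcsin_term z n.
Proof.
unfold arcsin_term; rewrite central_succ; assert (Q := binom_pos (2 * S n) (S n)).
set (c := binom (2 * S n) (S n)) in *; clearbody c.
change (z ^ S (S n)) with (z * z ^ S n); set (zn := z ^ S n).
rewrite !S_INR; assert (P := pos_INR n).
field; repeat split; lra.
Qed.

Lemma arcsin_term_0 (z : R) : arcsin_term z 0 = z / 2.
Proof. unfold arcsin_term, binom; simpl; field. Qed.

Lemma arcsin_term_geom (z : R) : 0 <= z < 4 ->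
  forall n, Rabs (arcsin_term z (S n)) <= z / 4 * Rabs (arcsin_term z n).
Proof.
intros Hz n; rewrite arcsin_term_succ, Rabs_mult; apply Rmult_le_compat_r; [apply Rabs_pos|].
assert (P := pos_INR n); set (y := INR n) in *; clearbody y.
rewrite Rabs_pos_eq by nonneg.
apply Rmult_le_reg_r with (4 * (2 * (y + 2) * (2 * y + 3))); [pos|].
replace (z * (y + 1) ^ 2 / (2 * (y + 2) * (2 * y + 3)) * (4 * (2 * (y + 2) * (2 * y + 3))))
  with (z * (4 * (y + 1) ^ 2)) by (field; lra).
replace (z / 4 * (4 * (2 * (y + 2) * (2 * y + 3)))) with (z * (2 * (y + 2) * (2 * y + 3))) by field.
apply Rmult_le_compat_l; [lra|]; poly_le.
Qed.

Lemma arcsin_term_lim0 (z : R) : 0 <= z < 4 -> is_lim_seq (arcsin_term z) 0.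
Proof.
intro Hz.
apply is_lim_seq_ext with (fun n => (1 + 0 * INR (S n) + 0 * INR (S n) ^ 2 + 0 * INR (S n) ^ 3
   + 0 * INR (S n) ^ 4 + 0 * INR (S n) ^ 5) * arcsin_term z n).
  intro n; ring.
apply (poly5_geom_lim (arcsin_term z) (z / 4)); [lra|now apply arcsin_term_geom].
Qed.

Lemma lim0_mult_bounded (u v : nat -> R) (C : R) :
  is_lim_seq u 0 -> (forall n, Rabs (v n) <= C) -> is_lim_seq (fun n => v n * u n) 0.
Proof.
intros Hu Hv; apply is_lim_seq_abs_0.
apply is_lim_seq_le_le with (fun _ => 0) (fun n => C * Rabs (u n)).
- intro n; split; [apply Rabs_pos|].
  rewrite Rabs_mult; apply Rmult_le_compat_r; [apply Rabs_pos|apply Hv].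
- apply is_lim_seq_const.
- replace 0 with (C * Rabs 0) by (rewrite Rabs_R0; ring).
  apply (is_lim_seq_scal_l _ C (Rabs 0)); exact (is_lim_seq_abs _ _ Hu).
Qed.

Lemma Rabs_frac_le (p q C : R) : 0 <= p -> 0 < q -> p <= C * q -> Rabs (p / q) <= C.
Proof.
intros; rewrite Rabs_pos_eq by nonneg.
apply Rmult_le_reg_r with q; [assumption|].
now unfold Rdiv; rewrite Rmult_assoc, Rinv_l, Rmult_1_r by lra.
Qed.

Lemma lim_of_diff (u : nat -> R) (l : R) :
  is_lim_seq (fun n => u n - l) 0 -> is_lim_seq u l.
Proof.
intro H; apply is_lim_seq_ext with (fun n => (u n - l) + l); [intro n; ring|].
replace (Finite l) with (Finite (0 + l)) by now rewrite Rplus_0_l.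
apply is_lim_seq_plus'; [exact H|apply is_lim_seq_const].
Qed.

Lemma mobius_lim (a b c d : R) : 0 < c -> 0 < d ->
  is_lim_seq (fun k => (a + b * INR k) / (c + d * INR k)) (b / d).
Proof.
intros Hc Hd; apply lim_of_diff.
assert (Hm := Rmin_pos c d Hc Hd); assert (H1 := Rmin_l c d); assert (H2 := Rmin_r c d).
(* The difference from the limit is [(a * d - b * c) / (d * (c + d * k))], and
   [c + d * y >= Rmin c d * (y + 1)]. *)
apply frac_lim0 with (C := Rabs (a * d - b * c) / (d * Rmin c d))
  (p := fun _ => Rabs (a * d - b * c)) (q := fun y => d * (c + d * y)).
- intro k; assert (Hk := pos_INR k).
  assert (0 <= d * INR k) by nra.
  rewrite <- (Rabs_pos_eq (d * (c + d * INR k))) by nra.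
  unfold Rdiv at 3; rewrite <- Rabs_inv, <- Rabs_mult; f_equal; field; split; lra.
- intros y Hy; assert (0 <= d * y) by nra; split; [nra|].
  assert (HA := Rabs_pos (a * d - b * c)).
  replace (Rabs (a * d - b * c) / (d * Rmin c d) * (d * (c + d * y)))
    with (Rabs (a * d - b * c) * ((c + d * y) / Rmin c d)) by (field; lra).
  apply Rmult_le_compat_l; [exact HA|].
  apply Rmult_le_reg_r with (Rmin c d); [exact Hm|].
  unfold Rdiv; rewrite Rmult_assoc, Rinv_l, Rmult_1_r by lra; nra.
Qed.

Lemma ex_series_inv_sqr : ex_series (fun n => / (INR n + 1) ^ 2).
Proof.
(* The majorant is [2 / (n + 1) - 2 / (n + 2) = 2 / ((n + 1) * (n + 2))], which telescopes. *)
apply (ex_series_le (fun n => / (INR n + 1) ^ 2)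
  (fun n => - (2 / (INR (S n) + 1)) - - (2 / (INR n + 1)))).
- intro n; change (Rabs (/ (INR n + 1) ^ 2)
    <= - (2 / (INR (S n) + 1)) - - (2 / (INR n + 1))).
  vars n O; rewrite Rabs_pos_eq by nonneg.
  apply Rmult_le_reg_r with ((x + 1) ^ 2 * (x + 2)); [pos|].
  apply Rminus_le_0; match goal with |- 0 <= ?e => replace e with x by (field; lra) end; lra.
- exists (- - (2 / (INR 0 + 1))).
  apply (is_series_telescope (fun n => - (2 / (INR n + 1)))).
  apply is_lim_seq_ext with (fun n => -2 * / (INR n + 1)); [intro n; unfold Rdiv; ring|].
  replace (Finite 0) with (Finite (-2 * 0)) by now rewrite Rmult_0_r.
  apply (is_lim_seq_scal_l _ (-2) 0), is_lim_seq_inv_succ.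
Qed.

(** * The boundary sums *)

Lemma derive_ext (f g : R -> R) (x l : R) :
  (forall t, f t = g t) -> is_derive f x l -> is_derive g x l.
Proof. exact (is_derive_ext f g x l). Qed.

(** Used in place of integration: applied to a remainder and to its derivative, it turns a bound on
    the second derivative into a bound on the remainder. *)
Lemma increment_bounds (F dF : R -> R) (b B : R) :
  0 <= b -> F 0 = 0 ->
  (forall t, 0 <= t <= b -> is_derive F t (dF t)) ->
  (forall t, 0 <= t <= b -> 0 <= dF t <= B) -> 0 <= F b <= B * b.
Proof.
intros Hb F0 HD HB.
destruct (MVT_gen F 0 b dF) as [c [Hc E]].
- intros t Ht; apply HD; rewrite Rmin_left, Rmax_right in Ht; lra.
- intros t Ht; rewrite Rmin_left, Rmax_right in Ht by lra.
  apply continuity_pt_filterlim, (ex_derive_continuous F); exists (dF t); now apply HD.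
- rewrite Rmin_left, Rmax_right in Hc by lra.
  assert (HBc := HB c Hc); rewrite F0, !Rminus_0_r in E; rewrite E; nra.
Qed.

(** With [z = 4 * sin t ^ 2] the expected sum is [2 * t ^ 2], with second derivative 4. Since
    [arcsin_d2 0] is the constant 4 and the second derivative of the n-th term is
    [arcsin_d2 n - arcsin_d2 (S n)], the second derivative of the remainder after term [N] is the
    single function [arcsin_d2 (S N)]. *)
Definition arcsin_d1 (n : nat) (t : R) : R :=
  8 * 4 ^ n / (INR (S n) * binom (2 * S n) (S n)) * (cos t * sin t ^ S (2 * n)).
Definition arcsin_d2 (n : nat) (t : R) : R := 4 * 4 ^ n / binom (2 * n) n * sin t ^ (2 * n).

Lemma arcsin_term_derive (n : nat) (t : R) : is_derive (fun t => arcsin_term (4 * sin t ^ 2) n) t (arcsin_d1 n t).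
Proof.
unfold arcsin_term, arcsin_d1.
assert (B := binom_pos (2 * S n) (S n)); assert (P := INR_S_gt0 n).
set (c := binom (2 * S n) (S n)) in *; clearbody c.
apply derive_ext with (fun t => / (INR (S n) ^ 2 * c) * (4 * sin t ^ 2) ^ S n).
  intro; unfold Rdiv; ring.
assert (H1 : is_derive (fun t => 4 * sin t ^ 2) t (8 * sin t * cos t)).
{ auto_derive; [exact I|simpl; ring]. }
assert (H2 := is_derive_scal _ t (/ (INR (S n) ^ 2 * c)) _ (is_derive_pow _ (S n) t _ H1)).
match type of H2 with is_derive _ _ ?a => match goal with |- is_derive _ _ ?b =>
  replace b with a; [exact H2|] end end.
change (pred (S n)) with n.
change (sin t ^ S (2 * n)) with (sin t * sin t ^ (2 * n)).
rewrite pow_mult, Rpow_mult_distr.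
set (m := INR (S n)) in *; clearbody m; field; lra.
Qed.

Lemma arcsin_d1_derive (n : nat) (t : R) : is_derive (arcsin_d1 n) t (arcsin_d2 n t - arcsin_d2 (S n) t).
Proof.
unfold arcsin_d1, arcsin_d2.
assert (B := binom_pos (2 * n) n); assert (P := pos_INR n).
assert (H2 := binom_2 n).
set (K := 8 * 4 ^ n / _).
assert (H1 : is_derive (fun t => cos t * sin t ^ S (2 * n)) t
  (- sin t * sin t ^ S (2 * n) + cos t * (INR (S (2 * n)) * cos t * sin t ^ (2 * n)))).
{ apply (is_derive_mult cos (fun t => sin t ^ S (2 * n))).
  - apply is_derive_cos.
  - apply (is_derive_pow sin (S (2 * n))), is_derive_sin.
  - intros; apply Rmult_comm. }
assert (H3 := is_derive_scal _ t K _ H1).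
match type of H3 with is_derive _ _ ?a => match goal with |- is_derive _ _ ?b =>
  replace b with a; [exact H3|] end end.
unfold K; clear H1 H3 K.
replace (2 * S n)%nat with (S (S (2 * n))) in * by lia.
set (c' := binom (S (S (2 * n))) (S n)) in *; set (c := binom (2 * n) n) in *.
assert (Hc' : c' = 2 * (2 * INR n + 1) * c / (INR n + 1)) by (rewrite <- H2; field; lra).
rewrite Hc'; clearbody c'; clearbody c.
change (4 ^ S n) with (4 * 4 ^ n).
change (sin t ^ S (S (2 * n))) with (sin t * (sin t * sin t ^ (2 * n))).
change (sin t ^ S (2 * n)) with (sin t * sin t ^ (2 * n)).
rewrite !S_INR, mult_INR; change (INR 2) with 2.
set (v := sin t ^ (2 * n)); set (w := 4 ^ n).
assert (HC : cos t * cos t = 1 - sin t * sin t)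
  by (assert (H := sin2_cos2 t); unfold Rsqr in H; lra).
replace (cos t * ((2 * INR n + 1) * cos t * v)) with ((2 * INR n + 1) * v * (cos t * cos t)) by ring.
rewrite HC; field; lra.
Qed.

(** The remainder and its derivative vanish at 0, and its second derivative [arcsin_d2 (S N)] is
    nonnegative and increasing up to [theta]. Two applications of [increment_bounds] leave
    [arcsin_d2 (S N) theta * theta * theta], which tends to 0 because [sin theta < 1]. *)
Lemma arcsin_term_arcsin (theta : R) : 0 <= theta < PI / 2 ->
  is_series (arcsin_term (4 * sin theta ^ 2)) (2 * theta ^ 2).
Proof.
intros [Ht Hp].
assert (Hs : forall t, 0 <= t <= theta -> 0 <= sin t <= sin theta).
{ intros t Hr; split; [apply sin_ge_0; lra|].
  apply sin_incr_1; lra. }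
set (z := 4 * sin theta ^ 2).
assert (Hz : 0 <= z < 4).
{ assert (0 <= sin theta) by (apply Hs; lra).
  assert (0 < cos theta) by (apply cos_gt_0; lra).
  assert (H2 := sin2_cos2 theta); unfold Rsqr in H2; unfold z; nra. }
assert (He : forall n t, 0 <= t <= theta -> 0 <= arcsin_d2 n t <= arcsin_d2 n theta).
{ intros n t Hr; unfold arcsin_d2; assert (B := binom_pos (2 * n) n).
  assert (0 < 4 ^ n) by (apply pow_lt; lra).
  assert (0 <= 4 * 4 ^ n / binom (2 * n) n) by (apply Rdiv_le_0_compat; lra).
  destruct (Hs t Hr); split.
  - apply Rmult_le_pos; [assumption|apply pow_le; lra].
  - apply Rmult_le_compat_l; [assumption|apply pow_incr; lra]. }
assert (E1 : forall N t, is_derive (fun t => 4 * t - sum_n (fun n => arcsin_d1 n t) N) t (arcsin_d2 (S N) t)).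
{ intros N t; induction N as [|N IH].
  - apply derive_ext with (fun t => 4 * t - arcsin_d1 0 t); [intro; now rewrite sum_O|].
    replace (arcsin_d2 1 t) with (4 - (arcsin_d2 0 t - arcsin_d2 1 t))
      by (unfold arcsin_d2 at 1, binom; simpl; field).
    apply (is_derive_minus (fun t => 4 * t) (arcsin_d1 0)); [|apply arcsin_d1_derive].
    auto_derive; [exact I|ring].
  - apply derive_ext with (fun t => (4 * t - sum_n (fun n => arcsin_d1 n t) N) - arcsin_d1 (S N) t).
      intro; rewrite sum_Sn; unfold plus; simpl; ring.
    replace (arcsin_d2 (S (S N)) t) with (arcsin_d2 (S N) t - (arcsin_d2 (S N) t - arcsin_d2 (S (S N)) t)) by ring.
    apply (is_derive_minus _ (arcsin_d1 (S N))); [exact IH|apply arcsin_d1_derive]. }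
assert (E2 : forall N t, is_derive (fun t => 2 * t ^ 2 - sum_n (arcsin_term (4 * sin t ^ 2)) N) t
   (4 * t - sum_n (fun n => arcsin_d1 n t) N)).
{ intros N t; induction N as [|N IH].
  - apply derive_ext with (fun t => 2 * t ^ 2 - arcsin_term (4 * sin t ^ 2) 0); [intro; now rewrite sum_O|].
    rewrite sum_O; apply (is_derive_minus (fun t => 2 * t ^ 2)); [|apply arcsin_term_derive].
    auto_derive; [exact I|simpl; ring].
  - apply derive_ext with (fun t => (2 * t ^ 2 - sum_n (arcsin_term (4 * sin t ^ 2)) N)
       - arcsin_term (4 * sin t ^ 2) (S N)).
      intro; rewrite sum_Sn; unfold plus; simpl; ring.
    replace (4 * t - sum_n (fun n => arcsin_d1 n t) (S N)) with
      ((4 * t - sum_n (fun n => arcsin_d1 n t) N) - arcsin_d1 (S N) t)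
      by (rewrite sum_Sn; unfold plus; simpl; ring).
    apply (is_derive_minus _ (fun t => arcsin_term (4 * sin t ^ 2) (S N))); [exact IH|apply arcsin_term_derive]. }
assert (Q0 : forall n, arcsin_d1 n 0 = 0).
{ intro n; unfold arcsin_d1; rewrite sin_0; simpl; ring. }
assert (A0 : forall n, arcsin_term (4 * sin 0 ^ 2) n = 0).
{ intro n; unfold arcsin_term; rewrite sin_0; simpl; unfold Rdiv; ring. }
assert (S0 : forall (a : nat -> R) N, (forall n, a n = 0) -> sum_n a N = 0).
{ intros a N Ha; transitivity (sum_n (fun _ => 0) N); [exact (sum_n_ext _ _ N Ha)|].
  rewrite sum_n_const; apply Rmult_0_r. }
assert (B1 : forall N t, 0 <= t <= theta ->
  0 <= 4 * t - sum_n (fun n => arcsin_d1 n t) N <= arcsin_d2 (S N) theta * theta).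
{ intros N t Hr.
  assert (H := increment_bounds (fun t => 4 * t - sum_n (fun n => arcsin_d1 n t) N) (arcsin_d2 (S N)) t (arcsin_d2 (S N) theta)).
  destruct H as [H1 H2]; [lra| |intros; apply E1|intros; apply He; lra|].
    rewrite (S0 (fun n => arcsin_d1 n 0)) by exact Q0; ring.
  split; [exact H1|]; apply Rle_trans with (1 := H2).
  assert (0 <= arcsin_d2 (S N) theta) by (apply (He (S N) theta); lra); nra. }
assert (B2 : forall N, 0 <= 2 * theta ^ 2 - sum_n (arcsin_term z) N <= arcsin_d2 (S N) theta * theta * theta).
{ intro N.
  apply (increment_bounds (fun t => 2 * t ^ 2 - sum_n (arcsin_term (4 * sin t ^ 2)) N)
    (fun t => 4 * t - sum_n (fun n => arcsin_d1 n t) N)); [exact Ht| |intros; apply E2|intros; now apply B1].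
  rewrite (S0 (arcsin_term (4 * sin 0 ^ 2))) by exact A0; simpl; ring. }
assert (El : is_lim_seq (fun N => arcsin_d2 (S N) theta) 0).
(* [arcsin_d2 (S n) theta] is [4 * k ^ 2] times the n-th term, where [k = n + 1]. *)
{ apply is_lim_seq_ext with (fun n => let k := INR (S n) in
    (0 + 0 * k + 4 * k ^ 2 + 0 * k ^ 3 + 0 * k ^ 4 + 0 * k ^ 5) * arcsin_term z n).
  - intro n; cbv zeta; unfold arcsin_term, arcsin_d2, z.
    assert (B := binom_pos (2 * S n) (S n)); assert (P := INR_S_gt0 n).
    rewrite Rpow_mult_distr, <- pow_mult; field; lra.
  - apply (poly5_geom_lim (arcsin_term z) (z / 4)); [lra|].
    now apply arcsin_term_geom. }
apply is_series_lim.
apply is_lim_seq_ext with (fun N => 2 * theta ^ 2 - (2 * theta ^ 2 - sum_n (arcsin_term z) N)); [intro; ring|].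
replace (Finite (2 * theta ^ 2)) with (Finite (2 * theta ^ 2 - 0)) by now rewrite Rminus_0_r.
apply is_lim_seq_minus'; [apply is_lim_seq_const|].
apply is_lim_seq_le_le with (fun _ => 0) (fun N => arcsin_d2 (S N) theta * (theta * theta)).
- intro N; specialize (B2 N); rewrite <- Rmult_assoc; exact B2.
- apply is_lim_seq_const.
- replace (Finite 0) with (Finite (0 * (theta * theta))) by now rewrite Rmult_0_l.
  apply is_lim_seq_mult'; [exact El|apply is_lim_seq_const].
Qed.
Lemma arcsin_term_1 : is_series (arcsin_term 1) (PI ^ 2 / 18).
Proof.
assert (H := arcsin_term_arcsin (PI / 6)); assert (P := PI_RGT_0).
rewrite sin_PI6 in H.
replace (4 * (1 / 2) ^ 2) with 1 in H by field.
replace (PI ^ 2 / 18) with (2 * (PI / 6) ^ 2) by field; apply H; lra.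
Qed.

Lemma arcsin_term_2 : is_series (arcsin_term 2) (PI ^ 2 / 8).
Proof.
assert (H := arcsin_term_arcsin (PI / 4)); assert (P := PI_RGT_0).
rewrite sin_PI4 in H.
replace (4 * (1 / sqrt 2) ^ 2) with 2 in H.
2:{ assert (H2 := sqrt_sqrt 2 ltac:(lra)).
    assert (0 < sqrt 2) by (apply sqrt_lt_R0; lra).
    replace (4 * (1 / sqrt 2) ^ 2) with (4 / (sqrt 2 * sqrt 2)) by (field; lra).
    rewrite H2; field. }
replace (PI ^ 2 / 8) with (2 * (PI / 4) ^ 2) by field; apply H; lra.
Qed.

Lemma arcsin_term_3 : is_series (arcsin_term 3) (2 * PI ^ 2 / 9).
Proof.
assert (H := arcsin_term_arcsin (PI / 3)); assert (P := PI_RGT_0).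
rewrite sin_PI3 in H.
replace (4 * (sqrt 3 / 2) ^ 2) with 3 in H.
2:{ assert (H2 := sqrt_sqrt 3 ltac:(lra)).
    replace (4 * (sqrt 3 / 2) ^ 2) with (sqrt 3 * sqrt 3) by field; lra. }
replace (2 * PI ^ 2 / 9) with (2 * (PI / 3) ^ 2) by field; apply H; lra.
Qed.

(** The grid joins two known convergent series: its boundary sum along [n = 0] is that of
    [1 / (k + 1) ^ 2], and along [k = 0] it gives three times the sum of [arcsin_term 1]. Uniqueness
    of sums then transfers the value. *)
Lemma zeta2 : is_series (fun n => / (INR n + 1) ^ 2) (PI ^ 2 / 6).
Proof.
destruct ex_series_inv_sqr as [u Hu].
(* The summand keeps [2 * INR 0] so that it has the form [g n O * hn n] of the transform; the
   evaluations below do the same. *)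
assert (H : is_series (fun n => (3 * INR n + 2 * INR 0 + 3) * (arcsin_term 1 n / (INR n + 1))) u).
{ apply (wz_transform0
    (fun n k => (INR n + 1) ^ 3 / (2 * (2 * INR n + 3) * (INR n + INR k + 2) ^ 2))
    (fun n k => (INR k + 1) ^ 2 / (INR n + INR k + 2) ^ 2)
    (fun n k => 2 * (2 * INR n + 1))
    (fun n k => 3 * INR n + 2 * INR k + 3)
    (fun k => / (2 * (INR k + 1) ^ 2)) _ (fun _ => 2) (3 / 4)).
  - lra.
  - wz_field.
  - wz_field.
  - intros n k; vars n k; apply Rabs_ratio_bound; [lra|nonneg|nonneg|nonneg|pos|poly_le].
  - intros n k; vars n k; apply Rabs_le_scaled; [nonneg|nonneg|poly_le].
  - intro k; vars O k; field; lra.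
  - intro n; rewrite arcsin_term_succ; vars n O; field; lra.
  - rewrite arcsin_term_0; simpl; field.
  - apply frac_lim0 with (C := 4) (p := fun y => 2 * y + 3) (q := fun y => 2 * (y + 1) ^ 2).
    + intro k; vars O k; rewrite Rabs_pos_eq by nonneg; field; lra.
    + intros y Hy; split; [pos|poly_le].
  - apply series_ext with (1 := Hu); intro k; vars O k; field; lra. }
assert (H' : is_series (fun n => (3 * INR n + 2 * INR 0 + 3) * (arcsin_term 1 n / (INR n + 1))) (PI ^ 2 / 6)).
{ apply series_scal with (1 := arcsin_term_1) (c := 3); [|field].
  intro n; vars n O; field; lra. }
apply is_series_unique in H; apply is_series_unique in H'.
replace (PI ^ 2 / 6) with u by congruence; exact Hu.
Qed.

(** * Grouped series: odd squares, alternating squares and K *)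

Lemma sum_n_group (a : nat -> R) (N : nat) :
  sum_n (fun i => a (2 * i)%nat + a (2 * i + 1)%nat) N = sum_n a (2 * N + 1).
Proof.
induction N as [|N IH]; [change (2 * 0 + 1)%nat with 1%nat; now rewrite sum_O, sum_Sn, sum_O|].
rewrite sum_Sn, IH. replace (2 * S N + 1)%nat with (S (S (2 * N + 1))) by lia.
rewrite !sum_Sn. replace (S (2 * N + 1)) with (2 * S N)%nat by lia.
replace (S (2 * S N)) with (2 * S N + 1)%nat by lia. unfold plus; simpl; ring.
Qed.

Lemma is_series_pairs (a : nat -> R) (l : R) :
  is_series a l -> is_series (fun i => a (2 * i)%nat + a (2 * i + 1)%nat) l.
Proof.
intro H; apply is_series_lim.
apply is_lim_seq_ext with (fun N => sum_n a (2 * N + 1)); [intro N; now rewrite sum_n_group|].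
apply (is_lim_seq_subseq (sum_n a) l (fun N => 2 * N + 1)%nat); [|exact H].
apply eventually_subseq; intro n; lia.
Qed.

Lemma sum_n_group3 (a : nat -> R) (N : nat) :
  sum_n (fun i => a (3 * i)%nat + a (3 * i + 1)%nat + a (3 * i + 2)%nat) N = sum_n a (3 * N + 2).
Proof.
induction N as [|N IH]; [change (3 * 0 + 2)%nat with 2%nat; now rewrite sum_O, !sum_Sn, sum_O|].
rewrite sum_Sn, IH. replace (3 * S N + 2)%nat with (S (S (S (3 * N + 2)))) by lia.
rewrite !sum_Sn. replace (S (3 * N + 2)) with (3 * S N)%nat by lia.
replace (S (3 * S N)) with (3 * S N + 1)%nat by lia.
replace (S (3 * S N + 1)) with (3 * S N + 2)%nat by lia. unfold plus; simpl; ring.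
Qed.

Lemma series_minus (a b c : nat -> R) (l m r : R) :
  is_series a l -> is_series b m -> (forall n, a n - b n = c n) -> l - m = r -> is_series c r.
Proof.
intros Ha Hb E <-; apply series_ext with (2 := E).
exact (is_series_minus a b l m Ha Hb).
Qed.

Lemma odd_basel : is_series (fun k => / (2 * INR k + 1) ^ 2) (PI ^ 2 / 8).
Proof.
assert (H1 := is_series_pairs _ _ zeta2).
assert (H2 : is_series (fun n => / 4 * / (INR n + 1) ^ 2) (/ 4 * (PI ^ 2 / 6)))
  by exact (is_series_scal (/ 4) _ _ zeta2).
apply series_minus with (1 := H1) (2 := H2); [|field].
intro n; rewrite plus_INR, mult_INR; change (INR 2) with 2; change (INR 1) with 1.
vars n O; field; lra.
Qed.

Lemma pow_m1_even (n : nat) : (-1) ^ (2 * n) = 1.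
Proof. apply pow_1_even. Qed.

(** Absolute convergence provides some sum; pairing consecutive terms identifies it as the odd
    squares minus a quarter of zeta(2). *)
Lemma eta2 : is_series (fun k => (-1) ^ k / (INR k + 1) ^ 2) (PI ^ 2 / 12).
Proof.
assert (Ex : ex_series (fun k => (-1) ^ k / (INR k + 1) ^ 2)).
{ apply (ex_series_le (fun k => (-1) ^ k / (INR k + 1) ^ 2) (fun n => / (INR n + 1) ^ 2));
    [|exact ex_series_inv_sqr].
  intro k; change (Rabs ((-1) ^ k / (INR k + 1) ^ 2) <= / (INR k + 1) ^ 2).
  unfold Rdiv; rewrite Rabs_mult, pow_1_abs, Rmult_1_l; vars O k.
  rewrite Rabs_pos_eq by nonneg; lra. }
destruct Ex as [u Hu].
assert (H1 := is_series_pairs _ _ Hu).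
assert (H2 : is_series (fun i => (-1) ^ (2 * i) / (INR (2 * i) + 1) ^ 2
   + (-1) ^ (2 * i + 1) / (INR (2 * i + 1) + 1) ^ 2) (PI ^ 2 / 12)).
{ assert (H3 : is_series (fun n => / 4 * / (INR n + 1) ^ 2) (/ 4 * (PI ^ 2 / 6)))
    by exact (is_series_scal (/ 4) _ _ zeta2).
  apply series_minus with (1 := odd_basel) (2 := H3); [|field].
  intro n; rewrite pow_add, pow_m1_even, plus_INR, mult_INR.
  change (INR 2) with 2; change (INR 1) with 1; vars n O; field; lra. }
apply is_series_unique in H1; apply is_series_unique in H2.
replace (PI ^ 2 / 12) with u by congruence; exact Hu.
Qed.

Lemma K_series : is_series (fun k => / (3 * INR k + 1) ^ 2 - / (3 * INR k + 2) ^ 2) const_K.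
Proof.
assert (Ex : ex_series (fun n : nat => IZR (legendre (S n) 3) / INR (S n) ^ 2)).
{ apply (ex_series_le (fun n : nat => IZR (legendre (S n) 3) / INR (S n) ^ 2)
    (fun n => / (INR n + 1) ^ 2)); [|exact ex_series_inv_sqr].
  intro k; change (Rabs (IZR (legendre (S k) 3) / INR (S k) ^ 2) <= / (INR k + 1) ^ 2).
  unfold Rdiv; rewrite Rabs_mult; vars O k.
  rewrite (Rabs_pos_eq (/ _)) by nonneg.
  rewrite <- (Rmult_1_l (/ (y + 1) ^ 2)) at 2.
  apply Rmult_le_compat_r; [nonneg|].
  rewrite legendre_3; destruct (S k mod 3) as [|[|m]];
    unfold Rabs; destruct Rcase_abs; lra. }
assert (H := Series_correct _ Ex); fold const_K in H.
apply is_series_lim.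
apply is_lim_seq_ext with
  (fun N => sum_n (fun n : nat => IZR (legendre (S n) 3) / INR (S n) ^ 2) (3 * N + 2)).
2:{ apply (is_lim_seq_subseq (sum_n (fun n : nat => IZR (legendre (S n) 3) / INR (S n) ^ 2))
      const_K (fun N => 3 * N + 2)%nat); [|exact H].
    apply eventually_subseq; intro n; lia. }
intro N; rewrite <- sum_n_group3; apply sum_n_ext; intro k.
rewrite !legendre_3.
replace (S (3 * k) mod 3) with 1%nat by (apply Nat.mod_unique with k; lia).
replace (S (3 * k + 1) mod 3) with 2%nat by (apply Nat.mod_unique with k; lia).
replace (S (3 * k + 2) mod 3) with 0%nat by (apply Nat.mod_unique with (S k); lia).
rewrite !S_INR, !plus_INR, mult_INR, INR_3; change (INR 2) with 2; change (INR 1) with 1.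
vars O k; eqR; field; lra.
Qed.

(* The even-index part of [K] is [- K / 4], because [(2 / 3) = -1]. *)
Lemma K_odd_series :
  is_series (fun j => / (INR j + 1 / 6) ^ 2 - / (INR j + 5 / 6) ^ 2) (45 * const_K).
Proof.
assert (H1 := is_series_pairs _ _ K_series).
assert (H2 := series_scal _ (fun k => - / 4 * (/ (3 * INR k + 1) ^ 2 - / (3 * INR k + 2) ^ 2))
  _ _ _ K_series (fun k => eq_refl) eq_refl).
apply series_scal with (c := 36)
  (a := fun n => / (6 * INR n + 1) ^ 2 - / (6 * INR n + 5) ^ 2) (l := 5 / 4 * const_K).
- apply series_minus with (1 := H1) (2 := H2); [|field].
  intro n; rewrite plus_INR, mult_INR; change (INR 2) with 2; change (INR 1) with 1.
  vars n O; field; lra.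
- intro n; vars n O; field; lra.
- field.
Qed.

(** * WZ evaluations *)

(** As in every evaluation below, the two summands are read off the axes: [f O k * h0 k] is the
    boundary summand, here [4 / (2 * k + 1) ^ 2], and [g n O * hn n] is the wanted one. *)
Lemma base_16 : is_series (fun n => (3 * INR (S n) + - 1) * term2 16 n) (PI ^ 2 / 2).
Proof.
apply is_series_ext with (fun n => (3 * INR n + 2 * INR 0 + 2) * term2 16 n).
  intro n; rewrite S_INR; simpl; ring.
apply (wz_transform0
  (fun n k => (2 * (INR n + 1) ^ 3) / ((2 * INR n + 3) * (2 * INR n + 2 * INR k + 3) ^ 2))
  (fun n k => (2 * INR k + 1) ^ 2 / (2 * INR n + 2 * INR k + 3) ^ 2)
  (fun n k => 2 * (2 * INR n + 1))
  (fun n k => 3 * INR n + 2 * INR k + 2)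
  (fun k => 2 / (2 * INR k + 1) ^ 2) _ (fun _ => 2) (3 / 4)).
- lra.
- wz_field.
- wz_field.
- intros n k; vars n k; apply Rabs_ratio_bound; [lra|nonneg|nonneg|nonneg|pos|poly_le].
- intros n k; vars n k; apply Rabs_le_scaled; [nonneg|nonneg|poly_le].
- intro k; vars O k; field; lra.
- intro n; rewrite term2_succ; vars n O; field; lra.
- rewrite term2_0; simpl; field.
- apply frac_lim0 with (C := 4) (p := fun y => (2 * y + 2) * 2) (q := fun y => (2 * y + 1) ^ 2).
  + intro k; vars O k; rewrite Rabs_pos_eq; [field; lra|nonneg].
  + intros y Hy; split; [pos|poly_le].
- apply series_scal with (1 := odd_basel) (c := 4); [|field].
  intro k; vars O k; field; lra.
Qed.

(** Zeilberger's series. At [y = 0] the certificate [s] factors as [(21 * x + 13) * (x + 1) ^ 3],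
    hence the division of [term2 1 n] by [(n + 1) ^ 3]; since [k = n + 1], the linear factor is
    [21 * k - 8]. The boundary sum is twice eta(2). Later certificates [g] carry similar extra
    factors at [y = 0]. *)
Lemma base_1 : is_series (fun n => (21 * INR (S n) + - 8) * term2 1 n) (PI ^ 2 / 6).
Proof.
set (s := fun x y => (13 + 60 * x + 102 * x ^ 2 + 76 * x ^ 3 + 21 * x ^ 4)
   + (30 + 102 * x + 114 * x ^ 2 + 42 * x ^ 3) * y
   + (24 + 54 * x + 30 * x ^ 2) * y ^ 2 + (8 + 9 * x) * y ^ 3 + y ^ 4).
apply series_ext with (fun n => s (INR n) (INR 0) * (term2 1 n / (INR n + 1) ^ 3)).
2:{ intro n; unfold s; vars n O; field; lra. }
apply (wz_transform0
  (fun n k => ((INR n + 1) ^ 3 * (INR n + INR k + 1) ^ 3)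
     / ((2 * INR n + INR k + 3) * (2 * INR n + INR k + 4)) ^ 3)
  (fun n k => - (INR n + INR k + 1) ^ 3 / (2 * INR n + INR k + 3) ^ 3)
  (fun n k => (3 * INR n + 2 * INR k + 2) * (2 * INR n + INR k + 2) ^ 3)
  (fun n k => s (INR n) (INR k))
  (fun k => (-1) ^ k / ((INR k + 1) * (INR k + 2)) ^ 3) _ (fun _ => 4) (3 / 4)).
- lra.
- wz_field.
- unfold s; wz_field.
- intros n k; unfold s; vars n k; apply Rabs_ratio_bound; [lra|nonneg|nonneg|nonneg|pos|poly_le].
- intros n k; unfold s; vars n k; apply Rabs_le_scaled; [nonneg|nonneg|poly_le].
- intro k; change ((-1) ^ S k) with (-1 * (-1) ^ k); vars O k; field; lra.
- intro n; rewrite term2_succ; vars n O; field; lra.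
- rewrite term2_0; simpl; field.
- apply frac_lim0 with (C := 100) (p := fun y => 13 + 30 * y + 24 * y ^ 2 + 8 * y ^ 3 + y ^ 4)
    (q := fun y => ((y + 1) * (y + 2)) ^ 3).
  + intro k; unfold s, Rdiv; rewrite !Rabs_mult, pow_1_abs; vars O k.
    rewrite !Rabs_pos_eq by nonneg; field; lra.
  + intros y Hy; split; [pos|poly_le].
- apply series_scal with (1 := eta2) (c := 2); [|field].
  intro k; vars O k; field; lra.
Qed.

(** The denominator of the axis values cancels against [f O k], so the boundary sum is four times
    that of [arcsin_term 2]. The geometric decay of [arcsin_term 2] makes the limit in [k]
    vanish. *)
Lemma base_8 :
  is_series (fun n => (10 * INR (S n) + - 3) * term3 8 n) (PI ^ 2 / 2).
Proof.
set (g := fun x y => 10 * x ^ 2 + 17 * x + 7 + 8 * x * y + 7 * y + 2 * y ^ 2).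
apply series_ext with (fun n => g (INR n) (INR 0) * (term3 8 n / (INR n + 1))).
2:{ intro n; unfold g; vars n O; field; lra. }
apply (wz_transform0
  (fun n k => (4 * (INR n + 1) ^ 2 * (INR n + INR k + 1) ^ 2)
     / ((3 * INR n + INR k + 4) * (3 * INR n + INR k + 5) * (3 * INR n + INR k + 6)
        * (2 * INR n + 2 * INR k + 3)))
  (fun n k => (INR n + INR k + 1) ^ 2 / ((3 * INR n + INR k + 4) * (2 * INR n + 2 * INR k + 3)))
  (fun n k => (3 * INR n + INR k + 2) * (3 * INR n + INR k + 3))
  (fun n k => g (INR n) (INR k))
  (fun k => 4 * arcsin_term 2 k / ((INR k + 2) * (INR k + 3))) _ (fun _ => 1) (3 / 4)).
- lra.
- wz_field.
- unfold g; wz_field.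
- intros n k; unfold g; vars n k; apply Rabs_ratio_bound; [lra|nonneg|nonneg|nonneg|pos|poly_le].
- intros n k; unfold g; vars n k; apply Rabs_le_scaled; [nonneg|nonneg|poly_le].
- intro k; rewrite arcsin_term_succ; vars O k; field; lra.
- intro n; rewrite term3_succ; vars n O; field; lra.
- rewrite term3_0, arcsin_term_0; simpl; field.
- apply is_lim_seq_ext with (fun k => (4 * (2 * INR k ^ 2 + 7 * INR k + 7))
    / ((INR k + 2) * (INR k + 3)) * arcsin_term 2 k).
    intro k; unfold g; vars O k; field; lra.
  apply lim0_mult_bounded with 8; [apply arcsin_term_lim0; lra|].
  intro k; vars O k; apply Rabs_frac_le; [nonneg|pos|poly_le].
- apply series_scal with (1 := arcsin_term_2) (c := 4); [|field].
  intro k; vars O k; field; lra.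
Qed.

Lemma base_81 :
  is_series (fun n => (35 * INR (S n) + - 8) * term4 81 n) (12 * PI ^ 2).
Proof.
set (g := fun x y => 70 * x ^ 3 + (159 + 63 * y) * x ^ 2 + (116 + 96 * y + 24 * y ^ 2) * x
  + (27 + 35 * y + 18 * y ^ 2 + 4 * y ^ 3)).
apply series_ext with (fun n => g (INR n) (INR 0) *
  (term4 81 n / ((2 * INR n + 1) * (INR n + 1)))).
2:{ intro n; unfold g; vars n O; field; lra. }
apply (wz_transform0
  (fun n k => (81 * (INR n + INR k + 1) * (INR n + 1) ^ 2 * (2 * INR n + INR k + 1)
       * (2 * INR n + INR k + 2))
     / (2 * (2 * INR n + 2 * INR k + 3) * (4 * INR n + INR k + 5) * (4 * INR n + INR k + 6)
        * (4 * INR n + INR k + 7) * (4 * INR n + INR k + 8)))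
  (fun n k => 3 * (INR n + INR k + 1) * (2 * INR n + INR k + 1)
     / (2 * (2 * INR n + 2 * INR k + 3) * (4 * INR n + INR k + 5)))
  (fun n k => (4 * INR n + INR k + 2) * (4 * INR n + INR k + 3) * (4 * INR n + INR k + 4))
  (fun n k => g (INR n) (INR k))
  (fun k => 54 * arcsin_term 3 k / ((INR k + 2) * (INR k + 3) * (INR k + 4))) _ (fun _ => 1) (3 / 4)).
- lra.
- wz_field.
- unfold g; wz_field.
- intros n k; unfold g; vars n k; apply Rabs_ratio_bound; [lra|nonneg|nonneg|nonneg|pos|poly_le].
- intros n k; unfold g; vars n k; apply Rabs_le_scaled; [nonneg|nonneg|poly_le].
- intro k; rewrite arcsin_term_succ; vars O k; field; lra.
- intro n; rewrite term4_succ; vars n O; field; lra.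
- rewrite term4_0, arcsin_term_0; simpl; field.
- apply is_lim_seq_ext with (fun k => (54 * (27 + 35 * INR k + 18 * INR k ^ 2 + 4 * INR k ^ 3))
    / ((INR k + 2) * (INR k + 3) * (INR k + 4)) * arcsin_term 3 k).
    intro k; unfold g; vars O k; field; lra.
  apply lim0_mult_bounded with 300; [apply arcsin_term_lim0; lra|].
  intro k; vars O k; apply Rabs_frac_le; [nonneg|pos|poly_le].
- apply series_scal with (1 := arcsin_term_3) (c := 54); [|field].
  intro k; vars O k; field; lra.
Qed.

(** [1 / (3 * k + 1) ^ 2 - 1 / (3 * k + 2) ^ 2] has numerator [3 * (2 * k + 1)], which is the linear
    factor of [f O k] up to a constant. This is how [K] enters. *)
Lemma base_minus_27 :
  is_series (fun n => (15 * INR (S n) + - 4) * term3 (-27) n) (- 27 * const_K).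
Proof.
set (g := fun x y => 45 * x ^ 2 + 63 * x + 22 + (36 + 54 * x) * y + 18 * y ^ 2).
apply series_ext with (fun n => g (INR n) (INR 0) * (term3 (-27) n / (3 * INR n + 2))).
2:{ intro n; unfold g; vars n O; field; lra. }
apply (wz_transform0
  (fun n k => - ((9 * (INR n + 1) ^ 3 * (3 * INR n + 2) * (3 * INR n + 4))
     / (2 * (2 * INR n + 3) * (3 * INR n + 3 * INR k + 4) ^ 2 * (3 * INR n + 3 * INR k + 5) ^ 2)))
  (fun n k => ((3 * INR k + 1) * (3 * INR k + 2)) ^ 2
     / ((3 * INR n + 3 * INR k + 4) * (3 * INR n + 3 * INR k + 5)) ^ 2)
  (fun n k => 18 * (1 + INR n + 2 * INR k) * (2 * INR n + 1))
  (fun n k => g (INR n) (INR k))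
  (fun k => - (9 / 2) / ((3 * INR k + 1) * (3 * INR k + 2)) ^ 2) _ (fun _ => 2) (3 / 4)).
- lra.
- wz_field.
- unfold g; wz_field.
- intros n k; unfold g; vars n k; apply Rabs_ratio_bound_neg;
    [lra|nonneg|nonneg|nonneg|pos|poly_le].
- intros n k; unfold g; vars n k; apply Rabs_le_scaled; [nonneg|nonneg|poly_le].
- intro k; vars O k; field; lra.
- intro n; rewrite term3_succ; vars n O; field; lra.
- rewrite term3_0; simpl; field.
- apply frac_lim0 with (C := 200) (p := fun y => 9 * (22 + 36 * y + 18 * y ^ 2))
    (q := fun y => 2 * ((3 * y + 1) * (3 * y + 2)) ^ 2).
  + intro k; unfold g; vars O k.
    match goal with |- Rabs ?e = _ => rewrite <- (Rabs_Ropp e) end.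
    rewrite Rabs_pos_eq; [field; lra|].
    match goal with |- 0 <= - (?a * (- ?b / ?c)) =>
      replace (- (a * (- b / c))) with (a * (b / c)) by (unfold Rdiv; ring) end; nonneg.
  + intros y Hy; split; [pos|poly_le].
- apply series_scal with (1 := K_series) (c := - 27); [|reflexivity].
  intro k; vars O k; field; lra.
Qed.

(* Here the certificate does not vanish as [k] grows: its limit is, up to a
   factor, the summand of [base_8], which contributes half of the value. *)
Lemma base_64 :
  is_series (fun n => (11 * INR (S n) + - 3) * term3 64 n) (8 * PI ^ 2).
Proof.
set (g := fun x y => 22 * x ^ 2 + 27 * x + 8 + 20 * x * y + 14 * y).
apply series_ext with (fun n => g (INR n) (INR 0) * (term3 64 n / (2 * INR n + 1))).
2:{ intro n; unfold g; vars n O; field; lra. }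
replace (8 * PI ^ 2) with (4 * PI ^ 2 + 4 * PI ^ 2) by ring.
apply (wz_transform
  (fun n k => (16 * (INR n + 1) ^ 3 * (2 * INR n + INR k + 1) * (2 * INR n + INR k + 2))
     / (3 * (3 * INR n + 4) * (3 * INR n + 5) * (2 * INR n + 3)
        * (2 * INR n + 2 * INR k + 3) * (INR n + 2 * INR k + 1)))
  (fun n k => 2 * (2 * INR k + 1) ^ 2 * (2 * INR n + INR k + 1)
     / ((2 * INR n + 2 * INR k + 3) * (INR n + 2 * INR k + 1) * (INR n + 2 * INR k + 2)))
  (fun n k => 3 * (3 * INR n + 2) * (3 * INR n + 1) * (2 * INR n + 1) / (INR n + 2 * INR k + 1))
  (fun n k => g (INR n) (INR k))
  (fun k => 16 / 3 / (2 * INR k + 1)) _ (fun n => 8 * ((10 * INR (S n) + - 3) * term3 8 n))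
  (fun _ => 3) (3 / 4)).
- lra.
- wz_field.
- unfold g; wz_field.
- intros n k; unfold g; vars n k; apply Rabs_ratio_bound;
    [lra|nonneg|nonneg|nonneg|pos|poly_le].
- intros n k; unfold g; vars n k; apply Rabs_le_scaled; [nonneg|nonneg|].
  apply Rmult_le_reg_r with (x + 2 * y + 1); [lra|].
  unfold Rdiv; rewrite Rmult_assoc, Rinv_l, Rmult_1_r by lra; poly_le.
- intro k; vars O k; field; lra.
- intro n; rewrite term3_succ; vars n O; field; lra.
- rewrite term3_0; simpl; field.
- rewrite term3_0; simpl INR; apply lim_of_diff.
  apply frac_lim0 with (C := 16 / 3) (p := fun y => 16 / 3) (q := fun y => 2 * y + 1).
  + intro k; unfold g; vars O k.
    transitivity (Rabs (16 / 3 / (2 * y + 1))); [f_equal; field; lra|].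
    apply Rabs_pos_eq; nonneg.
  + intros y Hy; split; [pos|poly_le].
(* The witness is the ratio of consecutive summands of [base_8]; the ratio of [G] in [n] must
   converge to it as [k] grows. *)
- intro n; right.
  exists ((10 * INR n + 17) / (10 * INR n + 7) *
    (4 * (INR n + 1) ^ 3 / (3 * (2 * INR n + 3) * (3 * INR n + 4) * (3 * INR n + 5)))).
  assert (Hg : forall k, 0 < g (INR n) (INR k)).
  { intro k; unfold g; vars n k; apply Rlt_le_trans with 8; [lra|poly_le]. }
  split; [|split].
  + assert (Hn := pos_INR n).
    (* For fixed [n] the ratio is a constant times three Moebius functions of [k], to which
       [mobius_lim] applies one by one. *)
    apply is_lim_seq_ext with (fun k =>
      16 * (INR n + 1) ^ 3 / (3 * (3 * INR n + 4) * (3 * INR n + 5) * (2 * INR n + 3))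
      * ((22 * (INR n + 1) ^ 2 + 27 * (INR n + 1) + 8 + (20 * (INR n + 1) + 14) * INR k)
         / (22 * INR n ^ 2 + 27 * INR n + 8 + (20 * INR n + 14) * INR k))
      * ((2 * INR n + 1 + 1 * INR k) / (2 * INR n + 3 + 2 * INR k))
      * ((2 * INR n + 2 + 1 * INR k) / (INR n + 1 + 2 * INR k))).
    { intro k; specialize (Hg k); unfold g in *; vars n k.
      field; repeat split; try lra; apply Rgt_not_eq; nra. }
    match goal with |- is_lim_seq _ (Finite ?l) => replace l with
      (16 * (INR n + 1) ^ 3 / (3 * (3 * INR n + 4) * (3 * INR n + 5) * (2 * INR n + 3))
       * ((20 * (INR n + 1) + 14) / (20 * INR n + 14)) * (1 / 2) * (1 / 2))
      by (field; repeat split; lra) end.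
    apply is_lim_seq_mult'; [apply is_lim_seq_mult'; [apply is_lim_seq_mult'|]|];
      [apply is_lim_seq_const|apply mobius_lim; nra ..].
  + intro k; apply Rgt_not_eq, Hg.
  + rewrite term3_succ; vars n O; field; lra.
- apply series_scal with (1 := odd_basel) (c := 32); [|field].
  intro k; vars O k; field; lra.
- apply series_scal with (1 := base_8) (c := 8); [reflexivity|field].
Qed.

(** * The Catalan constant and z = -8 *)

(** In closed form, [4^k k!^2 / ((2k+1) (4k+1)!!)]. *)
Definition catalan_weight : nat -> R := rprod (fun k => 4 * (INR k + 1) ^ 2 * (2 * INR k + 1)
   / ((4 * INR k + 3) * (4 * INR k + 5) * (2 * INR k + 3))).

Lemma catalan_weight_pos (k : nat) : 0 < catalan_weight k.
Proof.
induction k as [|k IH]; [unfold catalan_weight; simpl; lra|].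
unfold catalan_weight in *; cbn [rprod]; vars O k; pos.
Qed.

Lemma catalan_weight_geom (k : nat) : catalan_weight k <= (1 / 2) ^ k.
Proof.
induction k as [|k IH]; [unfold catalan_weight; simpl; lra|].
assert (Hp := catalan_weight_pos k); unfold catalan_weight in *; cbn [rprod]; change ((1 / 2) ^ S k) with (1 / 2 * (1 / 2) ^ k).
assert (Hy := pos_INR k); set (y := INR k) in *; clearbody y.
apply Rmult_le_compat; [nonneg|lra| |exact IH].
apply Rmult_le_reg_r with (2 * ((4 * y + 3) * (4 * y + 5) * (2 * y + 3))); [pos|].
field_simplify; [|lra]; poly_le.
Qed.

(** Along [k = 0] the grid is the Catalan series itself, whose terms decay only quadratically, so
    [wz_transform] with its geometric decay in [n] does not apply. The decay is geometric in [k]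
    instead: [H n k] is at most [(1/2)^k] times [H n O] in absolute value, which gives both the
    majorant and the zero limit. *)
Lemma catalan_leg :
  is_series (fun k => (6 * INR k + 5) / (2 * (4 * INR k + 3)) * catalan_weight k) Catalan_G.
Proof.
set (rho := fun n k => - ((2 * INR n + 1) * (2 * INR n + 2 * INR k + 1)
   / ((2 * INR n + 4 * INR k + 3) * (2 * INR n + 2 * INR k + 3)))).
set (kappa := fun n k => 4 * (INR k + 1) ^ 2 * (2 * INR n + 2 * INR k + 1)
   / ((2 * INR n + 4 * INR k + 3) * (2 * INR n + 4 * INR k + 5) * (2 * INR n + 2 * INR k + 3))).
set (f := fun n k => (5 + 6 * INR k + 2 * INR n) / (2 * (2 * INR n + 4 * INR k + 3))).
destruct (grid_exists rho kappa 1) as [H [H0 [HR HK]]]; [unfold rho, kappa; wz_field|].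
assert (E0 : forall k, H O k = catalan_weight k).
{ intro k; induction k as [|k IH]; [exact H0|].
  rewrite HK, IH; unfold catalan_weight, kappa; cbn [rprod]; vars O k; field; lra. }
assert (En : forall n, H n O = (-1) ^ n / (2 * INR n + 1) ^ 2).
{ intro n; induction n as [|n IH]; [rewrite H0; simpl; field|].
  rewrite HR, IH; unfold rho; change ((-1) ^ S n) with (-1 * (-1) ^ n).
  vars n O; field; lra. }
assert (Hk : forall n k, Rabs (H n k) <= (1 / 2) ^ k * Rabs (H n O)).
{ intros n k; apply (geometric_domination (fun k n => H n k) (1 / 2) k n); [lra|].
  intros i j; rewrite HK, Rabs_mult; apply Rmult_le_compat_r; [apply Rabs_pos|].
  unfold kappa; vars j i; apply Rabs_frac_le; [nonneg|pos|].
  apply Rmult_le_reg_l with 2; [lra|]; field_simplify; poly_le. }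
assert (Hpow : forall k, 0 <= (1 / 2) ^ k <= 1).
{ intro k; split; [apply pow_le; lra|].
  apply Rle_trans with (1 ^ k); [apply pow_incr; lra|rewrite pow1; lra]. }
destruct (wz_sum H (fun n k => f n k * H n k) (fun n => / (INR n + 1) ^ 2) (fun _ => 0) (fun _ => 1))
  as [_ HS].
- intros n k; rewrite HR, HK, <- !Rmult_assoc.
  replace (kappa n k * H n k - H n k) with ((kappa n k - 1) * H n k) by ring.
  rewrite <- Rmult_minus_distr_r; f_equal; unfold f, rho, kappa; vars n k; field; lra.
- exact ex_series_inv_sqr.
- intros n k; eapply Rle_trans; [apply Hk|].
  apply Rle_trans with (1 * Rabs (H n O)); [apply Rmult_le_compat_r; [apply Rabs_pos|apply Hpow]|].
  rewrite Rmult_1_l, En; unfold Rdiv; rewrite Rabs_mult, pow_1_abs, Rmult_1_l.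
  vars n O; rewrite Rabs_pos_eq by nonneg.
  apply Rinv_le_contravar; [pos|poly_le].
- intro n; apply is_lim_seq_abs_0.
  apply is_lim_seq_le_le with (fun _ => 0) (fun k => (1 / 2) ^ k * Rabs (H n O)).
  + intro k; split; [apply Rabs_pos|apply Hk].
  + apply is_lim_seq_const.
  + replace (Finite 0) with (Finite (0 * Rabs (H n O))) by now rewrite Rmult_0_l.
    apply is_lim_seq_mult'; [|apply is_lim_seq_const].
    apply is_lim_seq_geom; rewrite Rabs_pos_eq; lra.
- intros n k; rewrite Rabs_mult; apply Rmult_le_compat_r; [apply Rabs_pos|].
  unfold f; vars n k; apply Rabs_frac_le; [nonneg|pos|poly_le].
- replace Catalan_G with (Series (fun n => H n O) - Series (fun _ : nat => 0)).
  + apply series_ext with (1 := HS); intro k; rewrite E0; unfold f; vars O k; f_equal; field; lra.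
  + unfold Catalan_G; rewrite (Series_ext _ _ En).
    rewrite (is_series_unique (fun _ : nat => 0) 0); [ring|].
    apply is_series_lim, is_lim_seq_ext with (fun _ => 0); [|apply is_lim_seq_const].
    intro n; rewrite sum_n_const; ring.
Qed.

(** At [n = 0] the numerator of [f] is [12k^2 + 16k + 5 = (2k + 1)(6k + 5)]; the first factor
    cancels the denominator of the axis values, and what remains is -2 times the summand of
    [catalan_leg]. *)
Lemma base_minus_8 : is_series (fun n => (3 * INR (S n) + - 1) * term2 (-8) n) (- 2 * Catalan_G).
Proof.
apply series_ext with (fun n => (3 * INR n + 4 * INR 0 + 2) * term2 (-8) n).
2:{ intro n; vars n O; ring. }
apply (wz_transform0
  (fun n k => - ((INR n + 1) * (INR n + 2 * INR k + 1) ^ 2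
     / ((2 * INR n + 2 * INR k + 3) ^ 2 * (2 * INR n + 4 * INR k + 3))))
  (fun n k => (INR n + 2 * INR k + 1) ^ 2 * (INR n + 2 * INR k + 2) ^ 2
     / ((2 * INR n + 2 * INR k + 3) ^ 2 * (2 * INR n + 4 * INR k + 3) * (2 * INR n + 4 * INR k + 5)))
  (fun n k => (5 * INR n ^ 2 + 11 * INR n + 5 + 16 * INR n * INR k + 16 * INR k + 12 * INR k ^ 2)
     / (2 * INR n + 4 * INR k + 3))
  (fun n k => 3 * INR n + 4 * INR k + 2)
  (fun k => - catalan_weight k / (2 * INR k + 1)) _ (fun _ => 2) (3 / 4)).
- lra.
- wz_field.
- wz_field.
- intros n k; vars n k; apply Rabs_ratio_bound_neg; [lra|nonneg|nonneg|nonneg|pos|poly_le].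
- intros n k; vars n k; apply Rabs_le_scaled; [nonneg|nonneg|].
  apply Rmult_le_reg_r with (2 * x + 4 * y + 3); [lra|].
  unfold Rdiv; rewrite Rmult_assoc, Rinv_l, Rmult_1_r by lra; poly_le.
- intro k; unfold catalan_weight; cbn [rprod]; vars O k; field; lra.
- intro n; rewrite term2_succ; vars n O; field; lra.
- rewrite term2_0; unfold catalan_weight; simpl; field.
- apply is_lim_seq_ext with (fun k => -2 * catalan_weight k); [intro k; vars O k; field; lra|].
  replace (Finite 0) with (Finite (-2 * 0)) by now rewrite Rmult_0_r.
  apply (is_lim_seq_scal_l _ (-2) 0).
  apply is_lim_seq_le_le with (fun _ => 0) (fun k => (1 / 2) ^ k).
  + intro k; split; [apply Rlt_le, catalan_weight_pos|apply catalan_weight_geom].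
  + apply is_lim_seq_const.
  + apply is_lim_seq_geom; rewrite Rabs_pos_eq; lra.
- apply series_scal with (1 := catalan_leg) (c := -2); [|reflexivity].
  intro k; vars O k; field; lra.
Qed.

(** * The case z = -144 *)

(** In closed form, [(-1)^n n! / (2n+1)!!]. Multiplied by [2^n] these are the Taylor coefficients of
    [arcsinh y / sqrt (y^2 + 1)] at the odd powers of [y]. *)
Definition asinh_coef : nat -> R := rprod (fun i => - ((INR i + 1) / (2 * INR i + 3))).

Definition log_value : R := ln (2 + sqrt 3) / sqrt 3.

(** The n-th term of the expansion of [arcsinh]. As [dpsi 0] is the derivative of [arcsinh] and that
    of [psi n] is [dpsi n - dpsi (S n)], the remainder after term [N] has the single derivative
    [dpsi (S N)]. *)
Definition psi (n : nat) (y : R) : R := asinh_coef n * 2 ^ n * (sqrt (y ^ 2 + 1) * y ^ S (2 * n)).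
Definition dpsi (n : nat) (y : R) : R := asinh_coef n * 2 ^ n * (2 * INR n + 1) * y ^ (2 * n) / sqrt (y ^ 2 + 1).

Lemma psi_derive (n : nat) (y : R) : is_derive (psi n) y (dpsi n y - dpsi (S n) y).
Proof.
assert (Hs : 0 < y ^ 2 + 1) by nra.
assert (H2 := sqrt_sqrt (y ^ 2 + 1) ltac:(lra)).
assert (Hp := sqrt_lt_R0 _ Hs).
assert (H1 : is_derive (fun y => sqrt (y ^ 2 + 1)) y (y / sqrt (y ^ 2 + 1))).
{ auto_derive; [simpl in Hs; lra|].
  replace (y * (y * 1) + 1) with (y ^ 2 + 1) by (simpl; ring). field; lra. }
assert (H3 : is_derive (fun y => y ^ S (2 * n)) y (INR (S (2 * n)) * y ^ (2 * n))).
{ assert (H := is_derive_pow (fun y => y) (S (2 * n)) y 1 (is_derive_id y)).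
  change (pred (S (2 * n))) with (2 * n)%nat in H. rewrite Rmult_1_r in H; exact H. }
assert (H4 : is_derive (fun y => sqrt (y ^ 2 + 1) * y ^ S (2 * n)) y
  (y / sqrt (y ^ 2 + 1) * y ^ S (2 * n) + sqrt (y ^ 2 + 1) * (INR (S (2 * n)) * y ^ (2 * n)))).
{ exact (is_derive_mult _ _ y _ _ H1 H3 (fun a b => Rmult_comm a b)). }
assert (H5 := is_derive_scal _ y (asinh_coef n * 2 ^ n) _ H4).
unfold psi.
match type of H5 with is_derive _ _ ?a => match goal with |- is_derive _ _ ?b =>
  replace b with a; [exact H5|] end end.
unfold dpsi.
replace (asinh_coef (S n)) with (- ((INR n + 1) / (2 * INR n + 3)) * asinh_coef n) by reflexivity.
replace (2 * S n)%nat with (S (S (2 * n))) by lia.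
change (2 ^ S n) with (2 * 2 ^ n).
change (y ^ S (S (2 * n))) with (y * (y * y ^ (2 * n))).
change (y ^ S (2 * n)) with (y * y ^ (2 * n)).
rewrite !S_INR, mult_INR; change (INR 2) with 2.
assert (P := pos_INR n).
set (v := y ^ (2 * n)); set (w := 2 ^ n); set (s := sqrt (y ^ 2 + 1)) in *.
(* Writing the root as [(y ^ 2 + 1) * r], with [r] its inverse, makes both sides linear in [r] and
   leaves a rational identity. *)
assert (Es : s = (y ^ 2 + 1) * / s) by (rewrite <- H2; field; lra).
unfold Rdiv; set (r := / s) in *; clearbody r; rewrite Es; field; lra.
Qed.

Lemma asinh_coef_bound (n : nat) : Rabs (asinh_coef n * 2 ^ n) <= 1.
Proof.
induction n as [|n IH]; [unfold asinh_coef; simpl; rewrite Rabs_pos_eq; lra|].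
replace (asinh_coef (S n) * 2 ^ S n)
  with (- (2 * (INR n + 1) / (2 * INR n + 3)) * (asinh_coef n * 2 ^ n)).
2:{ assert (P := pos_INR n); unfold asinh_coef; cbn [rprod]; change (2 ^ S n) with (2 * 2 ^ n). field; lra. }
rewrite Rabs_mult, Rabs_Ropp, <- (Rmult_1_r 1).
assert (P := pos_INR n).
apply Rmult_le_compat; [apply Rabs_pos|apply Rabs_pos| |exact IH].
apply Rabs_frac_le; lra.
Qed.

(* [sqrt (y^2 + 1) * sum asinh_coef_n 2^n y^(2n+1) = arcsinh y], taken at [y = 1 / sqrt 2]. *)
Lemma asinh_coef_series : is_series asinh_coef log_value.
Proof.
set (b := / sqrt 2).
assert (H2 := sqrt_sqrt 2 ltac:(lra)). assert (H3 := sqrt_sqrt 3 ltac:(lra)).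
assert (P2 : 0 < sqrt 2) by (apply sqrt_lt_R0; lra).
assert (P3 : 0 < sqrt 3) by (apply sqrt_lt_R0; lra).
assert (Hb : b * b = / 2) by (unfold b; rewrite <- Rinv_mult, H2; reflexivity).
assert (Hb0 : 0 < b) by (apply Rinv_0_lt_compat, P2).
assert (Hsq : sqrt (b ^ 2 + 1) = b * sqrt 3).
{ apply sqrt_lem_1; [nra|nra|].
  replace (b * sqrt 3 * (b * sqrt 3)) with (b * b * (sqrt 3 * sqrt 3)) by ring.
  rewrite H3, Hb; simpl; rewrite Rmult_1_r, Hb; lra. }
assert (Has : arcsinh b = ln (2 + sqrt 3) / 2).
{ unfold arcsinh; rewrite Hsq.
  assert (Hpos : 0 < b + b * sqrt 3) by nra.
  (* The square of [b * (1 + sqrt 3)] is [(4 + 2 * sqrt 3) / 2 = 2 + sqrt 3]. *)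
  assert (E : ln ((b + b * sqrt 3) * (b + b * sqrt 3)) = ln (2 + sqrt 3)).
  { f_equal. replace ((b + b * sqrt 3) * (b + b * sqrt 3))
      with (b * b * (1 + 2 * sqrt 3 + sqrt 3 * sqrt 3)) by ring.
    rewrite Hb, H3; lra. }
  rewrite ln_mult in E by assumption; lra. }
set (F := fun N y => arcsinh y - sum_n (fun n => psi n y) N).
assert (HD : forall N y, is_derive (F N) y (dpsi (S N) y)).
{ assert (HA : forall y, is_derive arcsinh y (dpsi 0 y)).
  { intro y; assert (H := derivable_pt_lim_arcsinh y).
    apply is_derive_Reals in H.
    replace (dpsi 0 y) with (/ sqrt (y ^ 2 + 1)); [exact H|].
    unfold dpsi, asinh_coef; simpl (INR 0); simpl rprod; change (2 * 0)%nat with 0%nat; rewrite !pow_O.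
    unfold Rdiv; ring. }
  intros N y; induction N as [|N IH]; unfold F in *.
  - apply derive_ext with (fun y => arcsinh y - psi 0 y); [intro; now rewrite sum_O|].
    replace (dpsi 1 y) with (dpsi 0 y - (dpsi 0 y - dpsi 1 y)) by ring.
    apply (is_derive_minus arcsinh (psi 0)); [apply HA|apply psi_derive].
  - apply derive_ext with (fun y => (arcsinh y - sum_n (fun n => psi n y) N) - psi (S N) y).
      intro; rewrite sum_Sn; unfold plus; simpl; ring.
    replace (dpsi (S (S N)) y) with (dpsi (S N) y - (dpsi (S N) y - dpsi (S (S N)) y)) by ring.
    apply (is_derive_minus _ (psi (S N))); [exact IH|apply psi_derive]. }
assert (HF0 : forall N, F N 0 = 0).
{ intro N; unfold F; replace (arcsinh 0) with 0.
  - transitivity (0 - sum_n (fun _ => 0) N); [|rewrite sum_n_const; ring].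
    f_equal; apply sum_n_ext; intro n; eqR; unfold psi; simpl; ring.
  - unfold arcsinh; replace (0 + sqrt (0 ^ 2 + 1)) with 1; [now rewrite ln_1|].
    replace (0 ^ 2 + 1) with 1 by ring; rewrite sqrt_1; ring. }
(* In the mean value theorem the intermediate point satisfies [c ^ 2 <= b ^ 2 = 1 / 2], and
   [asinh_coef_bound] controls the coefficient, so the remainder decays like [N / 2^N]. *)
assert (Hbound : forall N, Rabs (F N b) <= (2 * INR (S N) + 1) * (1 / 2) ^ S N).
{ intro N.
  destruct (MVT_gen (F N) 0 b (dpsi (S N))) as [c [Hc E]].
  - intros t Ht; apply HD.
  - intros t Ht; apply continuity_pt_filterlim, (ex_derive_continuous (F N)).
    exists (dpsi (S N) t); apply HD.
  - rewrite Rmin_left, Rmax_right in Hc by lra.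
    rewrite HF0, !Rminus_0_r in E; rewrite E; unfold dpsi.
    assert (Hs1 : 1 <= sqrt (c ^ 2 + 1)).
    { rewrite <- sqrt_1 at 1; apply sqrt_le_1_alt; nra. }
    set (K := 2 * INR (S N) + 1).
    assert (HK : 0 < K) by (unfold K; assert (P := pos_INR (S N)); lra).
    replace (asinh_coef (S N) * 2 ^ S N * K * c ^ (2 * S N) / sqrt (c ^ 2 + 1) * b)
      with ((asinh_coef (S N) * 2 ^ S N) * (K * (c ^ 2) ^ S N * (b / sqrt (c ^ 2 + 1))))
      by (rewrite pow_mult; field; lra).
    rewrite Rabs_mult.
    assert (Hc2 : 0 <= c ^ 2 <= 1 / 2) by (simpl; nra).
    assert (Hcp : 0 <= (c ^ 2) ^ S N <= (1 / 2) ^ S N).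
    { split; [apply pow_le; lra|apply pow_incr; lra]. }
    assert (Hbs : 0 <= b / sqrt (c ^ 2 + 1) <= 1).
    { split; [apply Rdiv_le_0_compat; lra|].
      apply Rmult_le_reg_r with (sqrt (c ^ 2 + 1)); [lra|].
      unfold Rdiv; rewrite Rmult_assoc, Rinv_l by lra; nra. }
    rewrite <- (Rmult_1_l (K * (1 / 2) ^ S N)).
    apply Rmult_le_compat; [apply Rabs_pos|apply Rabs_pos|apply asinh_coef_bound|].
    assert (HX : 0 <= K * (c ^ 2) ^ S N) by (apply Rmult_le_pos; lra).
    rewrite Rabs_pos_eq by (apply Rmult_le_pos; lra).
    rewrite <- (Rmult_1_r (K * (1 / 2) ^ S N)).
    apply Rmult_le_compat; try lra.
    apply Rmult_le_compat_l; lra. }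
apply is_series_lim.
apply is_lim_seq_ext with (fun N => log_value - 2 / sqrt 3 * F N b).
{ intro N; unfold F, log_value; rewrite Has.
  assert (E : sum_n (fun n => psi n b) N = sqrt 3 / 2 * sum_n asinh_coef N).
  { rewrite <- (sum_n_mult_l (sqrt 3 / 2)); apply sum_n_ext; intro n; eqR; unfold psi.
    rewrite Hsq; change (b ^ S (2 * n)) with (b * b ^ (2 * n)).
    rewrite pow_mult. replace (b ^ 2) with (/ 2) by (simpl; lra).
    transitivity (b * b * sqrt 3 * asinh_coef n * (2 ^ n * (/ 2) ^ n)); [ring|].
    rewrite <- Rpow_mult_distr, Rinv_r, pow1, Hb by lra.
    unfold mult; simpl; field. }
  rewrite E; field; lra. }
replace (Finite log_value) with (Finite (log_value - 0)) by now rewrite Rminus_0_r.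
apply is_lim_seq_minus'; [apply is_lim_seq_const|].
replace (Finite 0) with (Finite (2 / sqrt 3 * 0)) by now rewrite Rmult_0_r.
apply (is_lim_seq_scal_l _ (2 / sqrt 3) 0).
apply is_lim_seq_abs_0.
apply is_lim_seq_le_le with (fun _ => 0) (fun N => (2 * INR (S N) + 1) * (1 / 2) ^ S N).
- intro N; split; [apply Rabs_pos|apply Hbound].
- apply is_lim_seq_const.
- apply is_lim_seq_ext with (fun N => (INR (S N) ^ 1 * (1 / 2) ^ N) + 1 / 2 * (1 / 2) ^ N).
    intro N; rewrite pow_1; change ((1 / 2) ^ S N) with (1 / 2 * (1 / 2) ^ N); field.
  replace (Finite 0) with (Finite (0 + 1 / 2 * 0)) by (f_equal; ring).
  apply is_lim_seq_plus'; [apply INR_mult_geom_lim; lra|].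
  apply (is_lim_seq_scal_l _ (1 / 2) 0), is_lim_seq_geom; rewrite Rabs_pos_eq; lra.
Qed.

(* The sum is [6] times the integral of [(1 - x^4) / (1 + x^6)] over [[0,1]]. *)
Lemma sixth_series :
  is_series (fun j => (-1) ^ j * (/ (INR j + 1 / 6) - / (INR j + 5 / 6))) (6 * log_value).
Proof.
assert (H3 := sqrt_sqrt 3 ltac:(lra)).
assert (P3 : 0 < sqrt 3) by (apply sqrt_lt_R0; lra).
assert (L3 : sqrt 3 < 2) by nra.
set (q := sqrt 3) in *.
(* A primitive of [(1 - x^4) / (1 + x^6)]: the common factor [1 + x^2] cancels, and the remaining
   denominator [x^4 - x^2 + 1] splits over [sqrt 3] into the two quadratics. The functions [p j]
   below integrate the terms of the geometric expansion of the same quotient. *)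
set (phi := fun x => (ln (x ^ 2 + q * x + 1) - ln (x ^ 2 - q * x + 1)) / (2 * q)).
set (p := fun j x => (-1) ^ j * (x ^ S (6 * j) / (6 * INR j + 1) - x ^ S (6 * j + 4) / (6 * INR j + 5))).
assert (Hphi : forall x, is_derive phi x ((1 - x ^ 4) / (1 + x ^ 6))).
{ intro x; unfold phi.
  assert (Q1 : 0 < x ^ 2 + q * x + 1) by (assert (0 <= (x + q / 2) ^ 2) by apply pow2_ge_0; nra).
  assert (Q2 : 0 < x ^ 2 - q * x + 1) by (assert (0 <= (x - q / 2) ^ 2) by apply pow2_ge_0; nra).
  assert (Q3 : 0 < 1 + x ^ 6) by (assert (0 <= (x ^ 3) ^ 2) by apply pow2_ge_0; simpl in *; lra).
  auto_derive; [simpl in *; repeat split; lra|].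
  replace (x * (x * 1) + q * x + 1) with (x ^ 2 + q * x + 1) by ring.
  replace (x * (x * 1) + - (q * x) + 1) with (x ^ 2 - q * x + 1) by ring.
  assert (E6 : 1 + x ^ 6 = (x ^ 2 + 1) * ((x ^ 2 + q * x + 1) * (x ^ 2 - q * x + 1))).
  { replace ((x ^ 2 + q * x + 1) * (x ^ 2 - q * x + 1)) with ((x ^ 2 + 1) ^ 2 - q * q * x ^ 2) by ring.
    rewrite H3; ring. }
  rewrite E6; field_simplify_eq; [|repeat split; try lra; nra]. ring. }
assert (Hp : forall j x, is_derive (p j) x ((-1) ^ j * (1 - x ^ 4) * (x ^ 6) ^ j)).
{ intros j x; unfold p.
  assert (A : forall m, is_derive (fun y => y ^ S m) x (INR (S m) * x ^ m)).
  { intro m. assert (H := is_derive_pow (fun y => y) (S m) x 1 (is_derive_id x)).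
    change (pred (S m)) with m in H; rewrite Rmult_1_r in H; exact H. }
  assert (P := pos_INR j).
  assert (B1 := is_derive_scal _ x (/ (6 * INR j + 1)) _ (A (6 * j)%nat)).
  assert (B2 := is_derive_scal _ x (/ (6 * INR j + 5)) _ (A (6 * j + 4)%nat)).
  assert (B3 : is_derive (fun y => (-1) ^ j * (/ (6 * INR j + 1) * y ^ S (6 * j)
      - / (6 * INR j + 5) * y ^ S (6 * j + 4))) x
    ((-1) ^ j * (/ (6 * INR j + 1) * (INR (S (6 * j)) * x ^ (6 * j))
      - / (6 * INR j + 5) * (INR (S (6 * j + 4)) * x ^ (6 * j + 4)))))
    by exact (is_derive_scal _ x ((-1) ^ j) _ (is_derive_minus _ _ x _ _ B1 B2)).
  match type of B3 with is_derive ?f _ ?a =>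
    apply (derive_ext f); [intro t; unfold Rdiv; ring|] end.
  match type of B3 with is_derive _ _ ?a => match goal with |- is_derive _ _ ?b =>
    replace b with a; [exact B3|] end end.
  rewrite !S_INR, plus_INR, mult_INR.
  replace (INR 6) with 6 by (simpl; ring). replace (INR 4) with 4 by (simpl; ring).
  rewrite <- (pow_mult x 6 j), pow_add.
  field; lra. }
set (F := fun N x => phi x - sum_n (fun j => p j x) N).
assert (HD : forall N x, is_derive (F N) x
   ((-1) ^ S N * ((1 - x ^ 4) * (x ^ 6) ^ S N / (1 + x ^ 6)))).
{ intros N x.
  assert (Q3 : 0 < 1 + x ^ 6) by (assert (0 <= (x ^ 3) ^ 2) by apply pow2_ge_0; simpl in *; lra).
  induction N as [|N IH]; unfold F in *.
  - apply derive_ext with (fun x => phi x - p 0%nat x); [intro; now rewrite sum_O|].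
    match goal with |- is_derive _ _ ?l =>
      replace l with ((1 - x ^ 4) / (1 + x ^ 6) - (-1) ^ 0 * (1 - x ^ 4) * (x ^ 6) ^ 0)
        by (simpl; field; simpl in Q3; lra) end.
    apply (is_derive_minus phi (p 0%nat)); [apply Hphi|apply Hp].
  - apply derive_ext with (fun x => (phi x - sum_n (fun j => p j x) N) - p (S N) x).
      intro; rewrite sum_Sn; unfold plus; simpl; ring.
    match goal with |- is_derive _ _ ?l =>
      replace l with ((-1) ^ S N * ((1 - x ^ 4) * (x ^ 6) ^ S N / (1 + x ^ 6))
        - (-1) ^ S N * (1 - x ^ 4) * (x ^ 6) ^ S N) end.
    + apply (is_derive_minus _ (p (S N))); [exact IH|apply Hp].
    + change ((-1) ^ S (S N)) with (-1 * (-1) ^ S N).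
      change ((x ^ 6) ^ S (S N)) with (x ^ 6 * (x ^ 6) ^ S N).
      field; lra. }
assert (HF0 : forall N, F N 0 = 0).
{ intro N; unfold F; replace (phi 0) with 0.
  - transitivity (0 - sum_n (fun _ => 0) N); [|rewrite sum_n_const; ring].
    f_equal; apply sum_n_ext; intro j; eqR; unfold p.
    rewrite !pow_i by lia; unfold Rdiv; rewrite !Rmult_0_l, Rminus_0_r; apply Rmult_0_r.
  - unfold phi; replace (0 ^ 2 + q * 0 + 1) with 1 by ring.
    replace (0 ^ 2 - q * 0 + 1) with 1 by ring; field; lra. }
assert (Hbound : forall N, Rabs (F N 1) <= / (INR N + 1)).
{ intro N.
  set (w := fun x : R => x ^ S (6 * S N) / (6 * INR (S N) + 1)).
  assert (PN := pos_INR (S N)).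
  assert (Hw : forall x, is_derive w x ((x ^ 6) ^ S N)).
  { intro x. assert (H := is_derive_pow (fun y => y) (S (6 * S N)) x 1 (is_derive_id x)).
    change (pred (S (6 * S N))) with (6 * S N)%nat in H; rewrite Rmult_1_r in H.
    assert (H' := is_derive_scal _ x (/ (6 * INR (S N) + 1)) _ H).
    unfold w; apply derive_ext with (fun y => / (6 * INR (S N) + 1) * y ^ S (6 * S N)).
      intro; unfold Rdiv; ring.
    match type of H' with is_derive _ _ ?a => match goal with |- is_derive _ _ ?b =>
      replace b with a; [exact H'|] end end.
    rewrite (S_INR (6 * S N)), mult_INR, <- pow_mult.
    replace (INR 6) with 6 by (simpl; ring); field; lra. }
  (* The derivative of [F N] is bounded in absolute value by that of [w], so both [w - F N] and
     [w + F N] are nondecreasing on the unit interval; together they bound the absolute value at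
     1. *)
  assert (Hmono : forall s, s = 1 \/ s = -1 -> 0 <= w 1 - s * F N 1).
  { intros s Hs.
    set (dG := fun x => (x ^ 6) ^ S N
      - s * ((-1) ^ S N * ((1 - x ^ 4) * (x ^ 6) ^ S N / (1 + x ^ 6)))).
    assert (HG : forall x, is_derive (fun x => w x - s * F N x) x (dG x)).
    { intro x; exact (is_derive_minus w (fun x => s * F N x) x _ _ (Hw x)
        (is_derive_scal (F N) x s _ (HD N x))). }
    apply (increment_bounds (fun x => w x - s * F N x) dG 1 2); [lra| |intros; apply HG|].
    - unfold w; rewrite HF0, pow_i by lia; unfold Rdiv; ring.
    - intros x Hx; unfold dG.
      set (v := (x ^ 6) ^ S N).
      assert (Hx6 : 0 <= x ^ 6 <= 1).
      { split; [apply pow_le; lra|rewrite <- (pow1 6); apply pow_incr; lra]. }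
      assert (Hx4 : 0 <= x ^ 4 <= 1).
      { split; [apply pow_le; lra|rewrite <- (pow1 4); apply pow_incr; lra]. }
      assert (Hv : 0 <= v <= 1).
      { split; [apply pow_le; lra|rewrite <- (pow1 (S N)); apply pow_incr; lra]. }
      assert (Hr : 0 <= (1 - x ^ 4) * v / (1 + x ^ 6) <= v).
      { split; [apply Rdiv_le_0_compat; nra|].
        apply Rmult_le_reg_r with (1 + x ^ 6); [lra|].
        unfold Rdiv; rewrite Rmult_assoc, Rinv_l by lra; nra. }
      assert (Hsg : s * (-1) ^ S N = 1 \/ s * (-1) ^ S N = -1).
      { assert (HA := pow_1_abs (S N)); unfold Rabs in HA; destruct Rcase_abs in HA; nra. }
      rewrite <- Rmult_assoc; destruct Hsg as [->| ->]; lra. }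
  assert (Hw1 : w 1 <= / (INR N + 1)).
  { unfold w; rewrite pow1, S_INR in *; unfold Rdiv; rewrite Rmult_1_l.
    assert (P := pos_INR N); apply Rinv_le_contravar; lra. }
  assert (A1 := Hmono 1 (or_introl eq_refl)). assert (A2 := Hmono (-1) (or_intror eq_refl)).
  apply Rabs_le; lra. }
assert (Hphi1 : phi 1 = log_value).
{ unfold phi, log_value; fold q.
  replace (1 ^ 2 + q * 1 + 1) with (2 + q) by ring.
  replace (1 ^ 2 - q * 1 + 1) with (2 - q) by ring.
  replace (2 - q) with (/ (2 + q)).
  - rewrite ln_Rinv by lra; field; lra.
  - apply Rmult_eq_reg_l with (2 + q); [|lra]; rewrite Rinv_r by lra; nra. }
apply is_series_lim.
apply is_lim_seq_ext with (fun N => 6 * log_value - 6 * F N 1).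
{ intro N; unfold F; rewrite Hphi1.
  rewrite Rmult_minus_distr_l.
  replace (6 * sum_n (fun j => p j 1) N) with (sum_n (fun j => 6 * p j 1) N)
    by exact (sum_n_mult_l 6 (fun j => p j 1) N).
  transitivity (sum_n (fun j => 6 * p j 1) N); [ring|].
  apply sum_n_ext; intro j; eqR; unfold p; rewrite !pow1; assert (P := pos_INR j).
  eqR; field; lra. }
replace (Finite (6 * log_value)) with (Finite (6 * log_value - 6 * 0)) by (f_equal; ring).
apply is_lim_seq_minus'; [apply is_lim_seq_const|].
apply (is_lim_seq_scal_l _ 6 0).
apply lim0_of_bound with 1; intro k; unfold Rdiv; rewrite Rmult_1_l; apply Hbound.
Qed.

(* [k!^2 / prod_(i <= k) ((i + 1/2)^2 - 1/9)] *)
Definition third_term : nat -> R := fun k => 36 / 5 * rprod (fun k =>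
  (INR k + 1) ^ 2 / ((INR k + 7 / 6) * (INR k + 11 / 6))) k.

Lemma third_term_pos (k : nat) : 0 < third_term k.
Proof.
unfold third_term; induction k as [|k IH]; [simpl; lra|].
cbn [rprod]; assert (P := pos_INR k).
apply Rmult_lt_0_compat; [lra|].
apply Rmult_lt_0_compat; [pos|lra].
Qed.

Lemma third_term_succ (k : nat) :
  third_term (S k) = (INR k + 1) ^ 2 / ((INR k + 7 / 6) * (INR k + 11 / 6)) * third_term k.
Proof. unfold third_term; cbn [rprod]; ring. Qed.

(** The sequence is positive and decreases, since [(k + 7/6)(k + 11/6) - (k + 1)(k + 2) = 5/36]. Its
    limit is kept as an abstract [c], because the terms containing it cancel in [base_minus_144]. *)
Lemma third_term_limit : exists c : R, is_lim_seq (fun k => (INR k + 1) * third_term k) c.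
Proof.
assert (H : ex_finite_lim_seq (fun k => (INR k + 1) * third_term k)).
{ apply ex_finite_lim_seq_decr with 0.
  - intro k; rewrite third_term_succ; assert (Hp := third_term_pos k); vars k O.
    rewrite <- Rmult_assoc; apply Rmult_le_compat_r; [lra|].
    apply Rmult_le_reg_r with ((x + 7 / 6) * (x + 11 / 6)); [pos|].
    apply Rminus_le_0; match goal with |- 0 <= ?e =>
      replace e with (5 / 36 * (x + 1)) by (field; lra) end; lra.
  - intro k; assert (P := pos_INR k); assert (Hp := third_term_pos k); nra. }
destruct H as [c Hc]; now exists c.
Qed.

Lemma third_term_bound (k : nat) : (INR k + 1) * third_term k <= 36 / 5.
Proof.
induction k as [|k IH]; [unfold third_term; simpl; lra|].
apply Rle_trans with (2 := IH); rewrite third_term_succ; assert (Hp := third_term_pos k); vars k O.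
rewrite <- Rmult_assoc; apply Rmult_le_compat_r; [lra|].
apply Rmult_le_reg_r with ((x + 7 / 6) * (x + 11 / 6)); [pos|].
apply Rminus_le_0; match goal with |- 0 <= ?e =>
  replace e with (5 / 36 * (x + 1)) by (field; lra) end; lra.
Qed.

(** The majorant for [shift_series], of order [k^(-3/2)]; it is compared with the telescoping
    differences of [4 / sqrt (k + 1)]. *)
Lemma ex_series_inv_three_halves :
  ex_series (fun k => / ((2 * INR k + 1) * sqrt (INR k + 1))).
Proof.
apply (ex_series_le (fun k => / ((2 * INR k + 1) * sqrt (INR k + 1)))
  (fun k => - (4 * / sqrt (INR (S k) + 1)) - - (4 * / sqrt (INR k + 1)))).
- intro k; change (Rabs (/ ((2 * INR k + 1) * sqrt (INR k + 1)))
    <= - (4 * / sqrt (INR (S k) + 1)) - - (4 * / sqrt (INR k + 1))).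
  vars k O; set (u := sqrt (x + 1)); set (v := sqrt (x + 1 + 1)).
  assert (Hu : 0 < u) by (apply sqrt_lt_R0; lra).
  assert (Hv : 0 < v) by (apply sqrt_lt_R0; lra).
  assert (Hu2 : u * u = x + 1) by (apply sqrt_sqrt; lra).
  assert (Hv2 : v * v = x + 2) by (unfold v; rewrite sqrt_sqrt; lra).
  assert (Huv : u <= v) by (apply sqrt_le_1_alt; lra).
  rewrite Rabs_pos_eq by nonneg.
  replace (- (4 * / v) - - (4 * / u)) with (4 * (v - u) / (u * v)) by (field; lra).
  replace (v - u) with (/ (u + v)) by (field_simplify_eq; nra).
  apply Rle_trans with (4 / ((2 * x + 1) * (4 * u))); [right; field; lra|].
  replace (4 * / (u + v) / (u * v)) with (4 / (u * (v * (u + v)))) by (field; lra).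
  apply Rmult_le_compat_l; [lra|].
  assert (0 < v * (u + v)) by nra.
  apply Rinv_le_contravar; [pos|].
  replace ((2 * x + 1) * (4 * u)) with (u * (4 * (2 * x + 1))) by ring.
  apply Rmult_le_compat_l; nra.
- exists (- - (4 * / sqrt (INR 0 + 1))).
  apply (is_series_telescope (fun n => - (4 * / sqrt (INR n + 1)))).
  apply is_lim_seq_ext with (fun n => -4 * sqrt (/ (INR n + 1))).
    intro n; rewrite sqrt_inv; ring.
  replace (Finite 0) with (Finite (-4 * sqrt 0)) by (rewrite sqrt_0; f_equal; ring).
  apply (is_lim_seq_scal_l _ (-4) (sqrt 0)).
  apply (is_lim_seq_continuous sqrt); [apply continuity_pt_sqrt; lra|apply is_lim_seq_inv_succ].
Qed.

(** The first quantity changes sign as [N] grows past [k], so positivity fails; six times it is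
    congruent to 1 or -1 modulo 6, hence nonzero. *)
Lemma half_third_nz (b0 : R) (N k : nat) : b0 = 1 / 3 \/ b0 = - (1 / 3) ->
  INR k + 1 / 2 - (INR N + b0) <> 0 /\ INR k + 1 / 2 + (INR N + b0) <> 0.
Proof.
intro Hb0; assert (PN := pos_INR N); assert (Pk := pos_INR k).
split; [|destruct Hb0; lra].
intro E.
assert (E6 : (6 * Z.of_nat k + 3 - 6 * Z.of_nat N - 2 = 0)%Z
   \/ (6 * Z.of_nat k + 3 - 6 * Z.of_nat N + 2 = 0)%Z).
{ rewrite !INR_IZR_INZ in E; destruct Hb0 as [H|H]; [left|right]; apply eq_IZR;
  rewrite ?plus_IZR, ?minus_IZR, ?plus_IZR, ?mult_IZR; lra. }
lia.
Qed.

(* With [b = N + b0], put [x(N,k) = b k!^2 / ((2k+1) prod_(i<=k) ((i+1/2)^2 - b^2))].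
   Then [x(N,k) - x(N+1,k)] telescopes in [k], and [sum_k x(N,k) -> 0] as [N -> oo]. *)
Lemma shift_series (b0 c : R) :
  b0 = 1 / 3 \/ b0 = - (1 / 3) ->
  is_lim_seq (fun k => (INR k + 1) * third_term k) c ->
  is_series (fun N => / (INR N + 1 / 2 + b0) ^ 2 - (-1) ^ N * c / (INR N + 1 / 2 + b0))
    (- Series (fun k => b0 * third_term k / (2 * INR k + 1))).
Proof.
intros Hb0 Hc.
set (b := fun N : nat => INR N + b0).
assert (denom_nz : forall N k, INR k + 1 / 2 - b N <> 0 /\ INR k + 1 / 2 + b N <> 0)
  by (intros N k; now apply half_third_nz).
(* For the product in [x(N,k)] without its factor [b / (2k+1)]: replacing [b] by [b + 1] shifts the
   factors [i + 1/2 - b] and [i + 1/2 + b] by one place, so only end factors survive. The minus sign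
   comes from [(b + 1/2) / (- b - 1/2)]. *)
set (rho := fun N k => - (INR k + 1 / 2 - b N) / (INR k + 3 / 2 + b N)).
set (kappa := fun N k => (INR k + 1) ^ 2 / ((INR k + 3 / 2 - b N) * (INR k + 3 / 2 + b N))).
assert (Hb2 : b0 * b0 = 1 / 9) by (destruct Hb0; subst; lra).
assert (HbS : forall N, b (S N) = b N + 1) by (intro N; unfold b; rewrite S_INR; ring).
assert (Hnz : forall N k, INR k + 1 / 2 - b N <> 0 /\ INR k + 3 / 2 - b N <> 0 /\
  INR k + 1 / 2 + b N <> 0 /\ INR k + 3 / 2 + b N <> 0 /\ INR k + 5 / 2 + b N <> 0 /\
  b N + 1 / 2 <> 0).
{ intros N k; destruct (denom_nz N k) as [A1 A2], (denom_nz N (S k)) as [A3 A4],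
    (denom_nz N (S (S k))) as [A5 A6], (denom_nz N 0%nat) as [A7 A8].
  rewrite !S_INR in *; change (INR 0) with 0 in *; repeat split; lra. }
destruct (grid_exists rho kappa (36 / 5)) as [E [E00 [ER EK]]].
{ intros N k; unfold rho, kappa; rewrite HbS, S_INR.
  destruct (Hnz N k) as [A1 [A2 [A3 [A4 [A5 A6]]]]].
  field; repeat split; try assumption; intro Z; [apply A5|apply A1|apply A2..]; lra. }
assert (E0 : forall k, E O k = third_term k).
{ intro k; induction k as [|k IH]; [rewrite E00; unfold third_term; simpl; field|].
  rewrite EK, IH, third_term_succ; unfold kappa, b; change (INR 0) with 0.
  f_equal; f_equal.
  replace ((INR k + 3 / 2 - (0 + b0)) * (INR k + 3 / 2 + (0 + b0)))
    with ((INR k + 3 / 2) ^ 2 - b0 * b0) by ring.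
  rewrite Hb2; field. }
assert (EN0 : forall N, E N O = / ((1 / 2 - b N) * (1 / 2 + b N))).
{ intro N; induction N as [|N IH].
  - rewrite E00; unfold b; change (INR 0) with 0.
    replace ((1 / 2 - (0 + b0)) * (1 / 2 + (0 + b0))) with (1 / 4 - b0 * b0) by field.
    rewrite Hb2; field.
  - rewrite ER, IH; unfold rho; rewrite HbS.
    destruct (Hnz N O) as [A1 [A2 [A3 [A4 [A5 A6]]]]]; change (INR 0) with 0 in *.
    field; repeat split; intro Z; [apply A4|apply A4|apply A3|apply A1]; lra. }
(* The weight is chosen to give decay in both directions at once, of order [1 / k] and [1 / N^2]. At
   [N = 0] it reduces to [third_term_bound], and multiplication by [rho] preserves it. *)
assert (Ebound : forall N k,
  Rabs (E N k) * (6 * (INR k + 1) + INR N ^ 2 + INR N) <= 6 * (36 / 5)).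
{ intros N k; induction N as [|N IH].
  - rewrite E0, Rabs_pos_eq by (apply Rlt_le, third_term_pos); change (INR 0) with 0.
    assert (H := third_term_bound k); simpl; lra.
  - apply Rle_trans with (2 := IH); rewrite ER, Rabs_mult.
    assert (HE := Rabs_pos (E N k)).
    rewrite (Rmult_comm (Rabs (rho N k))), Rmult_assoc.
    apply Rmult_le_compat_l; [exact HE|].
    destruct (Hnz N k) as [A1 [A2 [A3 [A4 [A5 A6]]]]].
    unfold rho, b in *; vars N k.
    assert (HD : 0 < y + 3 / 2 + (x + b0)) by (destruct Hb0; lra).
    rewrite Rabs_div, Rabs_Ropp, (Rabs_pos_eq (y + 3 / 2 + _)) by lra.
    apply Rmult_le_reg_r with (y + 3 / 2 + (x + b0)); [exact HD|].
    match goal with |- ?l <= _ => replace l with (Rabs (y + 1 / 2 - (x + b0)) *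
      (6 * (y + 1) + (x + 1) ^ 2 + (x + 1))) by (field; lra) end.
    unfold Rabs; destruct Rcase_abs; destruct Hb0; subst b0; nra. }
assert (xbound : forall k N r, 0 <= r ->
  (INR N + 1) <= r * (6 * (INR k + 1) + INR N ^ 2 + INR N) ->
  Rabs (- (b N * E N k / (2 * INR k + 1))) <= 6 * (36 / 5) * r / (2 * INR k + 1)).
{ intros k N r Hr Hle; assert (HEb := Ebound N k); assert (HE := Rabs_pos (E N k)).
  rewrite Rabs_Ropp; unfold b; vars N k.
  rewrite Rabs_div, (Rabs_pos_eq (2 * y + 1)), Rabs_mult by lra.
  apply Rmult_le_compat_r; [nonneg|].
  apply Rle_trans with ((x + 1) * Rabs (E N k)).
  - apply Rmult_le_compat_r; [exact HE|].
    apply Rabs_le; destruct Hb0; lra.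
  - apply Rle_trans with (r * (6 * (y + 1) + x ^ 2 + x) * Rabs (E N k)).
      now apply Rmult_le_compat_r.
    nra. }
assert (Glim : forall k, is_lim_seq (fun N => - (b N * E N k / (2 * INR k + 1))) 0).
{ intro k; apply lim0_of_bound with (6 * (36 / 5) * 2); intro N.
  apply Rle_trans with (6 * (36 / 5) * (2 / (INR N + 1)) / (2 * INR k + 1)).
  - apply xbound; vars N k; [nonneg|].
    apply Rmult_le_reg_r with (x + 1); [lra|].
    replace (2 / (x + 1) * (6 * (y + 1) + x ^ 2 + x) * (x + 1))
      with (2 * (6 * (y + 1) + x ^ 2 + x)) by (field; lra).
    poly_le.
  - vars N k.
    apply Rmult_le_reg_r with (2 * y + 1); [lra|].
    unfold Rdiv at 1; rewrite Rmult_assoc, Rinv_l, Rmult_1_r by lra.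
    replace (6 * (36 / 5) * (2 / (x + 1))) with (6 * (36 / 5) * 2 / (x + 1) * 1) by (field; lra).
    apply Rmult_le_compat_l; [nonneg|lra]. }
(* A majorant independent of [N]: from [2 * N * sqrt (k + 1) <= N^2 + k + 1], the factor [N + 1] is
   at most the weight of [Ebound] divided by [sqrt (k + 1)]. *)
assert (Dom : forall k N, Rabs (- (b N * E N k / (2 * INR k + 1)))
   <= 6 * (36 / 5) * / ((2 * INR k + 1) * sqrt (INR k + 1))).
{ intros k N; assert (Pk := pos_INR k).
  assert (Hu2 := sqrt_sqrt (INR k + 1) ltac:(lra)).
  assert (Hu1 : 1 <= sqrt (INR k + 1)) by (rewrite <- sqrt_1 at 1; apply sqrt_le_1_alt; lra).
  replace (6 * (36 / 5) * / ((2 * INR k + 1) * sqrt (INR k + 1)))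
    with (6 * (36 / 5) * / sqrt (INR k + 1) / (2 * INR k + 1)) by (field; lra).
  apply xbound; [apply Rlt_le, Rinv_0_lt_compat; lra|].
  rewrite <- Hu2 at 2; assert (PN := pos_INR N).
  set (u := sqrt (INR k + 1)) in *; set (x := INR N) in *; clearbody u x.
  apply Rmult_le_reg_l with u; [lra|].
  rewrite <- Rmult_assoc, Rinv_r, Rmult_1_l by lra.
  assert (0 <= (x - u) ^ 2) by apply pow2_ge_0; nra. }
(* As [k] grows [rho] tends to -1, so each shift of [b] reverses the sign of the limit. This
   produces the alternating series that carries the logarithm. *)
assert (Elim : forall N, is_lim_seq (fun k => (INR k + 1) * E N k) ((-1) ^ N * c)).
{ induction N as [|N IH].
  - rewrite Rmult_1_l; apply is_lim_seq_ext with (2 := Hc); intro k; now rewrite E0.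
  - apply is_lim_seq_ext with (fun k => (- (1 / 2 - b N) + -1 * INR k) / (3 / 2 + b N + 1 * INR k)
      * ((INR k + 1) * E N k)).
      intro k; rewrite ER; unfold rho; destruct (Hnz N k) as [A1 [A2 [A3 [A4 [A5 A6]]]]].
      field; repeat split; try assumption; intro Z; apply A4; lra.
    replace (Finite ((-1) ^ S N * c)) with (Finite (-1 / 1 * ((-1) ^ N * c)))
      by (f_equal; simpl; field).
    apply is_lim_seq_mult'; [apply mobius_lim; [|lra]|exact IH].
    unfold b; assert (PN := pos_INR N); destruct Hb0; lra. }
assert (Ulim : forall N, is_lim_seq (fun k => E N k * (INR k + 1 / 2 - b N) / (b N + 1 / 2))
   ((-1) ^ N * c / (INR N + 1 / 2 + b0))).
{ intro N; destruct (Hnz N O) as [_ [_ [_ [_ [_ A6]]]]].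
  apply is_lim_seq_ext with (fun k => (1 / 2 - b N + 1 * INR k) / (1 + 1 * INR k)
    * ((INR k + 1) * E N k) * / (b N + 1 / 2)).
    intro k; assert (Pk := pos_INR k); field; split; [|lra]; intro Z; apply A6; lra.
  replace (Finite ((-1) ^ N * c / (INR N + 1 / 2 + b0)))
    with (Finite (1 / 1 * ((-1) ^ N * c) * / (b N + 1 / 2))).
  2:{ f_equal; replace (INR N + 1 / 2 + b0) with (b N + 1 / 2) by (unfold b; ring).
      field; intro Z; apply A6; lra. }
  apply is_lim_seq_mult'; [|apply is_lim_seq_const].
  apply is_lim_seq_mult'; [apply mobius_lim; lra|apply Elim]. }
(* The roles are exchanged: the sum runs over [k], and [N] is the direction of the shift. Since [U]
   tends to a limit proportional to [c], the version with a far boundary [V] is required. *)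
destruct (wz_sum_lim (fun k N => - (b N * E N k / (2 * INR k + 1)))
  (fun k N => E N k * (INR k + 1 / 2 - b N) / (b N + 1 / 2))
  (fun k => 6 * (36 / 5) * / ((2 * INR k + 1) * sqrt (INR k + 1))) (fun _ => 0)
  (fun N => (-1) ^ N * c / (INR N + 1 / 2 + b0))) as [_ [_ HS]].
- intros k N; rewrite ER, EK; unfold rho, kappa; rewrite HbS, S_INR.
  destruct (Hnz N k) as [A1 [A2 [A3 [A4 [A5 A6]]]]]; assert (Pk := pos_INR k).
  field; repeat split; try assumption; lra.
- apply (ex_series_scal (6 * (36 / 5)) (fun k => / ((2 * INR k + 1) * sqrt (INR k + 1)))).
  exact ex_series_inv_three_halves.
- exact Dom.
- exact Glim.
- exact Ulim.
- rewrite (is_series_unique (fun _ : nat => 0) 0) in HS.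
  2:{ apply is_series_lim, is_lim_seq_ext with (fun _ => 0); [|apply is_lim_seq_const].
      intro n; rewrite sum_n_const; ring. }
  rewrite Rminus_0_r, Series_opp in HS.
  replace (Series (fun k => b0 * third_term k / (2 * INR k + 1)))
    with (Series (fun k => b O * E O k / (2 * INR k + 1))).
  2:{ apply Series_ext; intro k; rewrite E0; unfold b; simpl INR; f_equal; ring. }
  apply series_ext with (1 := HS); intro N; f_equal.
  rewrite EN0; destruct (Hnz N O) as [A1 [A2 [A3 [A4 [A5 A6]]]]]; change (INR 0) with 0 in *.
  replace (INR N + 1 / 2 + b0) with (b N + 1 / 2) by (unfold b; ring).
  field; repeat split; intro Z; [apply A6|apply A1]; lra.
Qed.

Lemma ex_series_X : ex_series (fun k => third_term k / (2 * INR k + 1)).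
Proof.
apply (ex_series_le (fun k => third_term k / (2 * INR k + 1)) (fun k => 36 / 5 * / (INR k + 1) ^ 2)).
- intro k; change (Rabs (third_term k / (2 * INR k + 1)) <= 36 / 5 * / (INR k + 1) ^ 2).
  assert (Hp := third_term_pos k); assert (Hb := third_term_bound k); vars k O.
  rewrite Rabs_pos_eq by nonneg.
  apply Rmult_le_reg_r with ((2 * x + 1) * (x + 1) ^ 2); [pos|].
  replace (third_term k / (2 * x + 1) * ((2 * x + 1) * (x + 1) ^ 2)) with ((x + 1) * ((x + 1) * third_term k)) by (field; lra).
  replace (36 / 5 * / (x + 1) ^ 2 * ((2 * x + 1) * (x + 1) ^ 2)) with ((2 * x + 1) * (36 / 5)) by (field; lra).
  apply Rmult_le_compat; nra.
- apply (ex_series_scal (36 / 5) (fun k => / (INR k + 1) ^ 2)), ex_series_inv_sqr.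
Qed.

(** The sums given by [shift_series] are odd in [b0]. Subtracting the case [1/3] from the case
    [-1/3] yields two thirds of [X] on one side; on the other, the squares combine to [K_odd_series]
    and the alternating terms to [sixth_series]. *)
Lemma X_value (c : R) :
  is_lim_seq (fun k => (INR k + 1) * third_term k) c ->
  is_series (fun k => third_term k / (3 * (2 * INR k + 1))) (45 / 2 * const_K - 3 * c * log_value).
Proof.
intro Hc.
set (X := Series (fun k => third_term k / (2 * INR k + 1))).
assert (SX : is_series (fun k => third_term k / (2 * INR k + 1)) X) by apply Series_correct, ex_series_X.
assert (EX : forall b, Series (fun k => b * third_term k / (2 * INR k + 1)) = b * X).
{ intro b; unfold X; rewrite <- Series_scal_l; apply Series_ext; intro k; unfold Rdiv; ring. }
assert (Sp := shift_series (1 / 3) c (or_introl eq_refl) Hc).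
assert (Sm := shift_series (- (1 / 3)) c (or_intror eq_refl) Hc).
rewrite EX in Sp, Sm.
assert (S1 := series_minus _ _ _ _ _ _ Sm Sp (fun n => eq_refl) eq_refl).
assert (S2 : is_series (fun j => c * ((-1) ^ j * (/ (INR j + 1 / 6) - / (INR j + 5 / 6)))) (c * (6 * log_value)))
  by exact (is_series_scal c _ _ sixth_series).
assert (S3 := series_minus _ _ _ _ _ _ K_odd_series S2 (fun n => eq_refl) eq_refl).
assert (E : - (- (1 / 3) * X) - - (1 / 3 * X) = 45 * const_K - c * (6 * log_value)).
{ rewrite <- (is_series_unique _ _ S1), <- (is_series_unique _ _ S3).
  apply Series_ext; intro n; vars n O.
  replace (x + 1 / 2 + - (1 / 3)) with (x + 1 / 6) by field.
  replace (x + 1 / 2 + 1 / 3) with (x + 5 / 6) by field.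
  field; lra. }
apply series_scal with (1 := SX) (c := / 3); [|lra].
intro k; vars k O; field; lra.
Qed.

Lemma base_minus_144 :
  is_series (fun n => (5 * INR (S n) + - 1) * term4 (-144) n) (- 45 / 2 * const_K).
Proof.
destruct third_term_limit as [c Hc]; assert (SX := X_value c Hc).
set (g := fun x y => 5 * x + 6 * y + 4).
apply series_ext with (fun n => g (INR n) (INR 0) * term4 (-144) n).
2:{ intro n; unfold g; vars n O; ring. }
(* The first summand is the boundary sum, minus the one in [X_value]; the second is the sum of the
   limits, by [asinh_coef_series]. *)
replace (- 45 / 2 * const_K)
  with (- (45 / 2 * const_K - 3 * c * log_value) + - 3 * c * log_value) by field.
apply (wz_transform
  (fun n k => - (18 * (INR n + 1) * (INR n + 2 * INR k + 1) * (INR n + INR k + 1)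
     / ((2 * INR n + 3) * (4 * INR n + 6 * INR k + 5) * (4 * INR n + 6 * INR k + 7))))
  (fun n k => 54 * (INR n + 2 * INR k + 1) * (INR n + 2 * INR k + 2) * (INR n + INR k + 1)
     / ((4 * INR n + 6 * INR k + 5) * (4 * INR n + 6 * INR k + 7) * (4 * INR n + 6 * INR k + 9)))
  (fun n k => (INR n + 2) * (2 * INR n + 1) / (4 * INR n + 6 * INR k + 5))
  (fun n k => g (INR n) (INR k))
  (fun k => - (third_term k * (6 * INR k + 5) / (6 * (2 * INR k + 1)))) _
  (fun n => - 3 * c * asinh_coef n) (fun _ => 1) (3 / 4)).
- lra.
- wz_field.
- unfold g; wz_field.
- intros n k; unfold g; vars n k; apply Rabs_ratio_bound_neg;
    [lra|nonneg|nonneg|nonneg|pos|poly_le].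
- intros n k; unfold g; vars n k; apply Rabs_le_scaled; [nonneg|nonneg|].
  apply Rmult_le_reg_r with (4 * x + 6 * y + 5); [lra|].
  unfold Rdiv; rewrite Rmult_assoc, Rinv_l, Rmult_1_r by lra; poly_le.
- intro k; rewrite third_term_succ; vars O k; field; lra.
- intro n; rewrite term4_succ; vars n O; field; lra.
- rewrite term4_0; unfold third_term; simpl; field.
- apply is_lim_seq_ext with (fun k => -1 * ((5 + 6 * INR k) / (6 + 12 * INR k))
    * ((4 + 6 * INR k) / (1 + 1 * INR k)) * ((INR k + 1) * third_term k)).
    intro k; unfold g; vars O k; field; lra.
  replace (Finite (-3 * c * asinh_coef 0)) with (Finite (-1 * (6 / 12) * (6 / 1) * c))
    by (f_equal; unfold asinh_coef; simpl; field).
  apply is_lim_seq_mult'; [|exact Hc].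
  apply is_lim_seq_mult'; [apply is_lim_seq_mult'; [apply is_lim_seq_const|]|];
    apply mobius_lim; lra.
(* For fixed [n] the ratio in [n] tends to the one that defines [asinh_coef], so the limits in [k]
   are multiples of these coefficients; the factor [-3 * c] is the limit found for [n = 0]. *)
- intro n; right; exists (- ((INR n + 1) / (2 * INR n + 3))).
  assert (Hg : forall k, 0 < g (INR n) (INR k)) by (intro k; unfold g; vars n k; lra).
  split; [|split].
  + assert (Hn := pos_INR n).
    apply is_lim_seq_ext with (fun k =>
      - (18 * (INR n + 1) / (2 * INR n + 3))
      * ((5 * INR n + 9 + 6 * INR k) / (5 * INR n + 4 + 6 * INR k))
      * ((INR n + 1 + 2 * INR k) / (4 * INR n + 5 + 6 * INR k))
      * ((INR n + 1 + 1 * INR k) / (4 * INR n + 7 + 6 * INR k))).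
    { intro k; specialize (Hg k); unfold g in *; vars n k; field; repeat split; lra. }
    replace (Finite (- ((INR n + 1) / (2 * INR n + 3)))) with
      (Finite (- (18 * (INR n + 1) / (2 * INR n + 3)) * (6 / 6) * (2 / 6) * (1 / 6)))
      by (f_equal; field; lra).
    apply is_lim_seq_mult'; [apply is_lim_seq_mult'; [apply is_lim_seq_mult'|]|];
      [apply is_lim_seq_const|apply mobius_lim; lra ..].
  + intro k; apply Rgt_not_eq, Hg.
  + unfold asinh_coef; cbn [rprod]; ring.
- apply series_scal with (1 := SX) (c := -1); [|ring].
  intro k; vars O k; field; lra.
- apply series_scal with (1 := asinh_coef_series) (c := -3 * c); reflexivity.
Qed.

(** * The sixteen identities *)

Lemma binom_2_shift (n : nat) :
  binom (2 * S n) (S n + 1) = INR (S n) / (INR (S n) + 1) * binom (2 * S n) (S n).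
Proof.
assert (P := INR_S_gt0 n).
assert (H := binom_succ_bottom (2 * S n) (S n) ltac:(lia)).
rewrite mult_INR, (S_INR (S n)) in H; change (INR 2) with 2 in H.
rewrite Nat.add_1_r; field_simplify_eq; lra.
Qed.

Lemma binom_3_shift (n : nat) :
  binom (3 * S n) (S n + 1) = 2 * INR (S n) / (INR (S n) + 1) * binom (3 * S n) (S n).
Proof.
assert (P := INR_S_gt0 n).
assert (H := binom_succ_bottom (3 * S n) (S n) ltac:(lia)).
rewrite mult_INR, (S_INR (S n)), INR_3 in H.
rewrite Nat.add_1_r; field_simplify_eq; lra.
Qed.

Lemma binom_4_shift (n : nat) :
  binom (4 * S n) (2 * S n + 1)
  = 2 * INR (S n) / (2 * INR (S n) + 1) * binom (4 * S n) (2 * S n).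
Proof.
assert (P := INR_S_gt0 n).
assert (H := binom_succ_bottom (4 * S n) (2 * S n) ltac:(lia)).
rewrite (S_INR (2 * S n)), !mult_INR, INR_4 in H; change (INR 2) with 2 in H.
rewrite Nat.add_1_r; field_simplify_eq; lra.
Qed.

Lemma is_series_shift (a : nat -> R) (l : R) :
  is_series (fun n => a (S n)) l -> is_series a (a O + l).
Proof.
intro H; apply is_series_decr_1.
match goal with |- is_series _ ?x => replace x with l; [exact H|] end.
unfold plus, opp; simpl; ring.
Qed.

Lemma series_from_0 (a b : nat -> R) (l l' : R) :
  is_series b l' -> (forall n, b n = a (S n)) -> l = a O + l' -> is_series_from 0 a l.
Proof.
intros H E ->; apply is_series_shift, is_series_ext with (1 := E), H.
Qed.

Lemma series_from_1 (a b : nat -> R) (l l' : R) :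
  is_series b l' -> (forall n, b n = a (S n)) -> l = l' -> is_series_from 1 a l.
Proof. intros H E ->; exact (is_series_ext _ _ _ E H). Qed.

(** Once shifted binomials are rewritten, both sides contain the same binomials and the same power
    of [z]; generalizing these leaves a rational identity. The rewriting of [S n - 1] serves the
    exponents [k - 1] in the identities that start at 1. *)
Ltac term_solve n :=
  cbv beta; assert (Pk := INR_S_gt0 n);
  assert (Q2 := binom_pos (2 * S n) (S n)); assert (Q3 := binom_pos (3 * S n) (S n));
  assert (Q4 := binom_pos (4 * S n) (2 * S n));
  rewrite ?binom_2_shift, ?binom_3_shift, ?binom_4_shift; unfold term2, term3, term4; rewrite ?pow1;
  set (k := INR (S n)) in *; set (c2 := binom (2 * S n) (S n)) in *;
  set (c3 := binom (3 * S n) (S n)) in *; set (c4 := binom (4 * S n) (2 * S n)) in *;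
  clearbody k c2 c3 c4; try (change (S n - 1)%nat with (n - 0)%nat; rewrite Nat.sub_0_r);
  simpl pow; try set (zn := pow _ n); field; repeat split; lra.

Ltac abs_lt := unfold Rabs; destruct Rcase_abs; lra.
Ltac poly := intro k; cbv beta; simpl pow; field.
Ltac sum_from_0 H := eapply series_from_0 with (1 := H);
  [let n := fresh "n" in intro n; term_solve n | unfold binom; simpl; field].
Ltac sum_from_1 H := eapply series_from_1 with (1 := H);
  [let n := fresh "n" in intro n; term_solve n | field].

Theorem theorem1p2 :
  is_series_from 0 (fun k : nat =>
    (198 * INR k ^ 2 - 227 * INR k + 47)
      / (binom (2 * k) k ^ 3))
    ((3264 - 4 * PI ^ 2) / 63) /\
  is_series_from 1 (fun k : nat =>
    (4884741 * INR k ^ 2 - 7292783 * INR k + 2041168)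
      / (binom (2 * k) (k + 1) ^ 3))
    ((68102148 - 10093535 * PI ^ 2) / 126) /\
  is_series_from 0 (fun k : nat =>
    (54 * INR k ^ 2 - 33 * INR k + 18) * (-8) ^ k
      / (binom (2 * k) k ^ 3))
    (8 + 2 * Catalan_G) /\
  is_series_from 1 (fun k : nat =>
    (11277 * INR k ^ 2 - 13124 * INR k + 3212) * (-8) ^ k
      / (binom (2 * k) (k + 1) ^ 3))
    ((38954 * Catalan_G - 24679) / 3) /\
  is_series_from 0 (fun k : nat =>
    (850 * INR k ^ 2 - 1133 * INR k + 69) * 8 ^ k
      / (binom (2 * k) k ^ 2 * binom (3 * k) k))
    ((885 - 12 * PI ^ 2) / 5) /\
  is_series_from 1 (fun k : nat =>
    (4621650 * INR k ^ 2 - 7550827 * INR k + 1785654) * 8 ^ k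
      / (binom (2 * k) (k + 1) ^ 2 * binom (3 * k) (k + 1)))
    ((6728880 - 1468127 * PI ^ 2) / 5) /\
  is_series_from 0 (fun k : nat =>
    (18 * INR k ^ 2 - 39 * INR k - 6) * 16 ^ k
      / (binom (2 * k) k ^ 3))
    ((16 - PI ^ 2) / 4) /\
  is_series_from 1 (fun k : nat =>
    (2778 * INR k ^ 2 - 6499 * INR k + 1679) * 16 ^ k
      / (binom (2 * k) (k + 1) ^ 3))
    ((89008 - 20305 * PI ^ 2) / 12) /\
  is_series_from 0 (fun k : nat =>
    (315 * INR k ^ 2 - 54 * INR k + 119) * (-27) ^ k
      / (binom (2 * k) k ^ 2 * binom (3 * k) k))
    ((10 + 216 * const_K) / 5) /\
  is_series_from 1 (fun k : nat =>
    (3391155 * INR k ^ 2 - 3249747 * INR k + 646792) * (-27) ^ (k - 1)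
      / (binom (2 * k) (k + 1) ^ 2 * binom (3 * k) (k + 1)))
    ((2344210 - 5115501 * const_K) / 30) /\
  is_series_from 0 (fun k : nat =>
    (1298 * INR k ^ 2 - 7807 * INR k - 3165) * 64 ^ k
      / (binom (2 * k) k ^ 2 * binom (3 * k) k))
    (195 - 192 * PI ^ 2) /\
  is_series_from 1 (fun k : nat =>
    (3470742 * INR k ^ 2 - 20527615 * INR k + 4631490) * 64 ^ (k - 1)
      / (binom (2 * k) (k + 1) ^ 2 * binom (3 * k) (k + 1)))
    (387807 - 198173 * PI ^ 2) /\
  is_series_from 0 (fun k : nat =>
    (2050 * INR k ^ 2 - 5331 * INR k - 1357) * 81 ^ k
      / (binom (2 * k) k ^ 2 * binom (4 * k) (2 * k)))
    ((8800 - 2592 * PI ^ 2) / 35) /\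
  is_series_from 1 (fun k : nat =>
    (17439700 * INR k ^ 2 - 47250409 * INR k + 8929776) * 81 ^ (k - 1)
      / (binom (2 * k) (k + 1) ^ 2 * binom (4 * k) (2 * k + 1)))
    ((143153685 - 44613764 * PI ^ 2) / 210) /\
  is_series_from 0 (fun k : nat =>
    (50 * INR k ^ 2 + 93 * INR k + 22) * (-144) ^ k
      / (binom (2 * k) k ^ 2 * binom (4 * k) (2 * k)))
    ((243 * const_K - 200) / 4) /\
  is_series_from 1 (fun k : nat =>
    (53725 * INR k ^ 2 - 27494 * INR k + 3675) * (-144) ^ (k - 1)
      / (binom (2 * k) (k + 1) ^ 2 * binom (4 * k) (2 * k + 1)))
    ((78296 - 122235 * const_K) / 128).
Proof.
split; [|split; [|split; [|split; [|split; [|split; [|split; [|split; [|split; [|split;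
  [|split; [|split; [|split; [|split; [|split]]]]]]]]]]]]]].
(* The polynomial passed to a reduction is the stated numerator times [k ^ 3], which compensates the
   [k ^ 3] in the denominator of the terms; the summand at [k = 0] is added separately. *)
- sum_from_0 (term2_reduction 1 21 (-8) (-8/21)
     (-64/21) (-72/7) (-176/7) _
     (fun k => (198 * k ^ 2 - 227 * k + 47) * k ^ 3)
     ltac:(abs_lt) base_1 ltac:(poly)).
(* Each inverse of [binom (2 * k) (k + 1)] contributes [(k + 1) / k] relative to the central
   binomial, so [k ^ 3] becomes [(k + 1) ^ 3]. *)
- sum_from_1 (term2_reduction 1 21 (-8) (-10093535/21)
     (-37883752/21) (-13297712/7) (-4341992/7) _
     (fun k => (4884741 * k ^ 2 - 7292783 * k + 2041168) * (k + 1) ^ 3)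
     ltac:(abs_lt) base_1 ltac:(poly)).
- sum_from_0 (term2_reduction (-8) 3 (-1) (-1)
     (-1) (-3) (-6) _
     (fun k => (54 * k ^ 2 - 33 * k + 18) * k ^ 3)
     ltac:(abs_lt) base_minus_8 ltac:(poly)).
- sum_from_1 (term2_reduction (-8) 3 (-1) (-19477/3)
     (-9841/3) (-3693) (-1253) _
     (fun k => (11277 * k ^ 2 - 13124 * k + 3212) * (k + 1) ^ 3)
     ltac:(abs_lt) base_minus_8 ltac:(poly)).
- sum_from_0 (term3_reduction 8 10 (-3) (-24/5)
     (-36/5) (-114/5) (-51) _
     (fun k => (850 * k ^ 2 - 1133 * k + 69) * k ^ 3)
     ltac:(abs_lt) base_8 ltac:(poly)).
(* The inverse of [binom (3 * k) (k + 1)] contributes [(k + 1) / (2 * k)], whence the division by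
   2. *)
- sum_from_1 (term3_reduction 8 10 (-3) (-2936254/5)
     (-4344627/10) (-2181099/5) (-277299/2) _
     (fun k => (4621650 * k ^ 2 - 7550827 * k + 1785654) * ((k + 1) ^ 3 / 2))
     ltac:(abs_lt) base_8 ltac:(poly)).
- sum_from_0 (term2_reduction 16 3 (-1) (-1/2)
     (-1/2) (-3/2) (-3) _
     (fun k => (18 * k ^ 2 - 39 * k - 6) * k ^ 3)
     ltac:(abs_lt) base_16 ltac:(poly)).
- sum_from_1 (term2_reduction 16 3 (-1) (-20305/6)
     (-10231/6) (-3081/2) (-463) _
     (fun k => (2778 * k ^ 2 - 6499 * k + 1679) * (k + 1) ^ 3)
     ltac:(abs_lt) base_16 ltac:(poly)).
- sum_from_0 (term3_reduction (-27) 15 (-4) (-8/5)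
     (-16/5) (-44/5) (-14) _
     (fun k => (315 * k ^ 2 - 54 * k + 119) * k ^ 3)
     ltac:(abs_lt) base_minus_27 ltac:(poly)).
(* The exponent [k - 1] in the statement accounts for the additional division by [z], here and in
   the later identities starting at 1. *)
- sum_from_1 (term3_reduction (-27) 15 (-4) (189463/30)
     (896677/135) (1070738/135) (75359/27) _
     (fun k => (3391155 * k ^ 2 - 3249747 * k + 646792) * ((k + 1) ^ 3 / 2) / (-27))
     ltac:(abs_lt) base_minus_27 ltac:(poly)).
- sum_from_0 (term3_reduction 64 11 (-3) (-24)
     (-36) (-102) (-177) _
     (fun k => (1298 * k ^ 2 - 7807 * k - 3165) * k ^ 3)
     ltac:(abs_lt) base_64 ltac:(poly)).
- sum_from_1 (term3_reduction 64 11 (-3) (-198173/8)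
     (-2440407/128) (-869997/64) (-473283/128) _
     (fun k => (3470742 * k ^ 2 - 20527615 * k + 4631490) * ((k + 1) ^ 3 / 2) / 64)
     ltac:(abs_lt) base_64 ltac:(poly)).
- sum_from_0 (term4_reduction 81 35 (-8) (-216/35)
     (-576/35) (-1704/35) (-656/7) _
     (fun k => (2050 * k ^ 2 - 5331 * k - 1357) * k ^ 3)
     ltac:(abs_lt) base_81 ltac:(poly)).
(* Here one of the three factors is [(2 * k + 1) / (2 * k)], from [binom (4 * k) (2 * k + 1)]. *)
- sum_from_1 (term4_reduction 81 35 (-8) (-11153441/630)
     (-81750932/2835) (-27072376/945) (-5580704/567) _
     (fun k => (17439700 * k ^ 2 - 47250409 * k + 8929776) * ((k + 1) ^ 2 * (2 * k + 1) / 2) / 81)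
     ltac:(abs_lt) base_81 ltac:(poly)).
- sum_from_0 (term4_reduction (-144) 5 (-1) (-27/10)
     (-9/10) (-21/10) (-1) _
     (fun k => (50 * k ^ 2 + 93 * k + 22) * k ^ 3)
     ltac:(abs_lt) base_minus_144 ltac:(poly)).
- sum_from_1 (term4_reduction (-144) 5 (-1) (8149/192)
     (5699/576) (9577/576) (2149/288) _
     (fun k => (53725 * k ^ 2 - 27494 * k + 3675) * ((k + 1) ^ 2 * (2 * k + 1) / 2) / (-144))
     ltac:(abs_lt) base_minus_144 ltac:(poly)).
Qed.
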